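(* Let $I$ be a dominant monomial ideal of $R=K[x_1,\ldots,x_n]$. Then the following conditions are equivalent: (i) $R/I$ is Cohen-Macaulay; (ii) $I$ is unmixed; (iii) $I$ is a complete intersection.
   Context: $K$ is a field and $R=K[x_1,\ldots,x_n]$ is the polynomial ring. For a monomial ideal $I$ of $R$, $G(I)$ denotes its unique minimal set of monomial generators. A monomial ideal $I$ is dominant if for every monomial $m\in G(I)$ there is a variable $x_k$ whose exponent in $m$ is strictly greater than its exponent in every other element of $G(I)$. $I$ is a complete intersection if $\operatorname{height}(I)=|G(I)|$. $I$ is unmixed if all associated primes of $R/I$ have the same height. *)

(* Defs.v *)
From HB Require Import structures.
From mathcomp Require Import all_boot all_algebra finmap ring.
From mathcomp Require Import ring_quotient generic_quotient mpoly boolp.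

Set Implicit Arguments.
Unset Strict Implicit.
Unset Printing Implicit Defensive.

Import GRing.Theory.
Local Open Scope ring_scope.
Local Open Scope quotient_scope.

Section Localization.
Variables (A : comNzRingType) (P : prime_idealr A).

Record fracpair := FracPair { fracval :> A * A; _ : fracval.2 \notin P }.

HB.instance Definition _ := [isSub for fracval].
HB.instance Definition _ := [Choice of fracpair by <:].

Lemma fracpair_den (x : fracpair) : x.2 \notin P. Proof. by case: x. Qed.

Lemma notin_prime1 : 1 \notin P. Proof. by rewrite idealr1. Qed.

Lemma notin_primeM s t : s \notin P -> t \notin P -> s * t \notin P.
Proof. by move=> sP tP; rewrite prime_idealrM negb_or sP. Qed.

Definition mkfrac a s (sP : s \notin P) : fracpair := @FracPair (a, s) sP.

Definition loceqv (x y : fracpair) : bool :=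
  `[< exists2 t, t \notin P & t * (x.1 * y.2 - y.1 * x.2) = 0 >].

Lemma loceqv_refl : reflexive loceqv.
Proof.
by move=> x; apply/asboolP; exists 1; rewrite ?notin_prime1 // subrr mulr0.
Qed.

Lemma loceqv_sym : ssrbool.symmetric loceqv.
Proof.
suff sub x y : loceqv x y -> loceqv y x by move=> x y; apply/idP/idP => /sub.
move=> /asboolP[t tP txy]; apply/asboolP; exists t => //.
by rewrite -opprB mulrN txy oppr0.
Qed.

Lemma loceqv_trans : transitive loceqv.
Proof.
move=> y x z /asboolP[t tP txy] /asboolP[u uP uyz]; apply/asboolP.
exists (t * u * y.2); first by rewrite !notin_primeM ?fracpair_den.
have -> : t * u * y.2 * (x.1 * z.2 - z.1 * x.2) =
    u * z.2 * (t * (x.1 * y.2 - y.1 * x.2)) +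
    t * x.2 * (u * (y.1 * z.2 - z.1 * y.2)) by ring.
by rewrite txy uyz !mulr0 addr0.
Qed.

Canonical loceqv_equiv := EquivRel loceqv loceqv_refl loceqv_sym loceqv_trans.

Definition localization := {eq_quot loceqv}.
HB.instance Definition _ : EqQuotient _ loceqv localization :=
  EqQuotient.on localization.
HB.instance Definition _ := Choice.on localization.

(* [locfrac a sP] is the fraction a / s of A_P *)
Definition locfrac a s (sP : s \notin P) : localization :=
  \pi_localization (mkfrac a sP).

Lemma locfracE a s (sP : s \notin P) b t (tP : t \notin P) :
  locfrac a sP = locfrac b tP <-> exists2 u, u \notin P & u * (a * t - b * s) = 0.
Proof.
rewrite /locfrac; split.
  by move=> /eqmodP /asboolP.
by move=> h; apply/eqmodP/asboolP.
Qed.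

Lemma locfracP (x : localization) :
  exists a s (sP : s \notin P), x = locfrac a sP.
Proof.
by elim/quotW: x => -[[a s] sP]; exists a, s, sP.
Qed.

Let num (x : localization) := (repr x).1.
Let den (x : localization) := (repr x).2.
Let denP x : den x \notin P := fracpair_den (repr x).

Lemma locfrac_repr x : x = locfrac (num x) (denP x).
Proof.
rewrite -{1}[x]reprK /locfrac; congr (\pi_localization _).
by apply: val_inj; rewrite /= [LHS]surjective_pairing.
Qed.

Lemma locfrac_numden a s (sP : s \notin P) :
  exists2 u, u \notin P & u * (num (locfrac a sP) * s - a * den (locfrac a sP)) = 0.
Proof. by apply/(locfracE _ (denP _) _ sP); rewrite -locfrac_repr. Qed.

Definition locadd x y :=
  locfrac (num x * den y + num y * den x) (notin_primeM (denP x) (denP y)).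
Definition locmul x y :=
  locfrac (num x * num y) (notin_primeM (denP x) (denP y)).
Definition locopp x := locfrac (- num x) (denP x).

Lemma locaddE a s (sP : s \notin P) b t (tP : t \notin P) :
  locadd (locfrac a sP) (locfrac b tP) =
  locfrac (a * t + b * s) (notin_primeM sP tP).
Proof.
have [u uP hu] := locfrac_numden a sP; have [v vP hv] := locfrac_numden b tP.
apply/locfracE; exists (u * v); first exact: notin_primeM.
move: hu hv; set c := num _; set d := den _; set e := num _; set f := den _.
move=> hu hv.
have -> : u * v * ((c * f + e * d) * (s * t) - (a * t + b * s) * (d * f)) =
  v * f * t * (u * (c * s - a * d)) + u * d * s * (v * (e * t - b * f)) by ring.
by rewrite hu hv !mulr0 addr0.
Qed.

Lemma locmulE a s (sP : s \notin P) b t (tP : t \notin P) :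
  locmul (locfrac a sP) (locfrac b tP) =
  locfrac (a * b) (notin_primeM sP tP).
Proof.
have [u uP hu] := locfrac_numden a sP; have [v vP hv] := locfrac_numden b tP.
apply/locfracE; exists (u * v); first exact: notin_primeM.
move: hu hv; set c := num _; set d := den _; set e := num _; set f := den _.
move=> hu hv.
have -> : u * v * (c * e * (s * t) - a * b * (d * f)) =
  v * e * t * (u * (c * s - a * d)) + u * a * d * (v * (e * t - b * f)) by ring.
by rewrite hu hv !mulr0 addr0.
Qed.

Lemma locoppE a s (sP : s \notin P) :
  locopp (locfrac a sP) = locfrac (- a) sP.
Proof.
have [u uP hu] := locfrac_numden a sP; apply/locfracE; exists u => //.
by rewrite !mulNr opprK addrC -opprB mulrN hu oppr0.
Qed.

Lemma eq_locfrac a s (sP : s \notin P) b t (tP : t \notin P) :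
  a * t = b * s -> locfrac a sP = locfrac b tP.
Proof.
move=> e; apply/locfracE; exists 1; first exact: notin_prime1.
by rewrite e subrr mulr0.
Qed.

Definition loc0 := locfrac 0 notin_prime1.
Definition loc1 := locfrac 1 notin_prime1.

Lemma locaddA : associative locadd.
Proof.
move=> x y z; have [a [s [sP ->]]] := locfracP x.
have [b [t [tP ->]]] := locfracP y; have [c [u [uP ->]]] := locfracP z.
by rewrite !locaddE; apply: eq_locfrac; ring.
Qed.

Lemma locaddC : commutative locadd.
Proof.
move=> x y; have [a [s [sP ->]]] := locfracP x.
have [b [t [tP ->]]] := locfracP y.
by rewrite !locaddE; apply: eq_locfrac; ring.
Qed.

Lemma locadd0 : left_id loc0 locadd.
Proof.
move=> x; have [a [s [sP ->]]] := locfracP x.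
by rewrite !locaddE; apply: eq_locfrac; ring.
Qed.

Lemma locaddN : left_inverse loc0 locopp locadd.
Proof.
move=> x; have [a [s [sP ->]]] := locfracP x.
by rewrite locoppE locaddE; apply: eq_locfrac; ring.
Qed.

HB.instance Definition _ :=
  GRing.isZmodule.Build localization locaddA locaddC locadd0 locaddN.

Lemma locmulA : associative locmul.
Proof.
move=> x y z; have [a [s [sP ->]]] := locfracP x.
have [b [t [tP ->]]] := locfracP y; have [c [u [uP ->]]] := locfracP z.
by rewrite !locmulE; apply: eq_locfrac; ring.
Qed.

Lemma locmulC : commutative locmul.
Proof.
move=> x y; have [a [s [sP ->]]] := locfracP x.
have [b [t [tP ->]]] := locfracP y.
by rewrite !locmulE; apply: eq_locfrac; ring.
Qed.

Lemma locmul1 : left_id loc1 locmul.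
Proof.
move=> x; have [a [s [sP ->]]] := locfracP x.
by rewrite !locmulE; apply: eq_locfrac; ring.
Qed.

Lemma locmulDl : left_distributive locmul locadd.
Proof.
move=> x y z; have [a [s [sP ->]]] := locfracP x.
have [b [t [tP ->]]] := locfracP y; have [c [u [uP ->]]] := locfracP z.
by rewrite !(locaddE, locmulE); apply: eq_locfrac; ring.
Qed.

Lemma loc1_neq0 : loc1 != loc0.
Proof.
apply/eqP => /locfracE[u uP]; rewrite mulr1 mul0r subr0 mulr1 => u0.
by move: uP; rewrite u0 idealr0.
Qed.

HB.instance Definition _ := GRing.Zmodule_isComNzRing.Build localization
  locmulA locmulC locmul1 locmulDl loc1_neq0.

End Localization.

Section CommutativeAlgebra.
Variable A : comNzRingType.
Implicit Types (I J : idealr A) (P Q : prime_idealr A) (s : seq A).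

Definition ideal_gen (S : A -> Prop) (f : A) : Prop :=
  exists (s : seq A) (c : nat -> A),
    (forall g, g \in s -> S g) /\ f = \sum_(i < size s) c i * s`_i.

Definition generates (S : A -> Prop) I : Prop :=
  forall f, f \in I <-> ideal_gen S f.

(* The type [idealr A] only contains proper ideals; the unit ideal, generated
   by 1, is left out of every quantification over ideals. *)
Definition noetherian : Prop :=
  forall I, exists s : seq A, generates (fun g => g \in s) I.

Definition maximal_ideal I : Prop :=
  forall J : idealr A, {subset I <= J} -> {subset J <= I}.

(* Only p 0, ..., p d matter; the values of p beyond d are junk. *)
Definition prime_chain (d : nat) (p : nat -> prime_idealr A) : Prop :=
  forall i, (i < d)%N ->
    {subset p i <= p i.+1} /\ ~ {subset p i.+1 <= p i}.

Definition height_ge P (d : nat) : Prop :=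
  exists2 p, prime_chain d p & p d =i P.

Definition prime_height P (h : nat) : Prop :=
  height_ge P h /\ forall d, height_ge P d -> (d <= h)%N.

(* The relational form of "the minimum of the heights of the primes containing
   I is h": a prime of infinite height satisfies height_ge for every h. *)
Definition height I (h : nat) : Prop :=
  (exists2 P : prime_idealr A, {subset I <= P} & prime_height P h) /\
  forall P : prime_idealr A, {subset I <= P} -> height_ge P h.

Definition krull_dim (d : nat) : Prop :=
  (exists p, prime_chain d p) /\
  forall e p, prime_chain e p -> (e <= d)%N.

Definition regular_seq s : Prop :=
  (forall i, (i < size s)%N -> forall b,
     ideal_gen (fun g => g \in take i s) (s`_i * b) ->
     ideal_gen (fun g => g \in take i s) b) /\
  ~ ideal_gen (fun g => g \in s) 1.

Definition depth I (d : nat) : Prop :=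
  (exists s, [/\ {subset s <= I}, regular_seq s & size s = d]) /\
  forall s, {subset s <= I} -> regular_seq s -> (size s <= d)%N.

Definition local_ring I : Prop :=
  maximal_ideal I /\ forall J, maximal_ideal J -> J =i I.

Definition associated_prime I P : Prop :=
  exists u : {ideal_quot I}, forall a, a \in P <-> \pi_{ideal_quot I} a * u = 0.

Definition unmixed I : Prop :=
  exists h, forall P, associated_prime I P -> prime_height P h.

End CommutativeAlgebra.

Definition local_cohen_macaulay (B : comNzRingType) : Prop :=
  exists2 M : idealr B, local_ring M & exists2 d, krull_dim B d & depth M d.

Definition cohen_macaulay (A : comNzRingType) : Prop :=
  noetherian A /\
  forall P : prime_idealr A, maximal_ideal P ->
    local_cohen_macaulay (localization P).

Section MonomialIdeals.
Variables (K : fieldType) (n : nat).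
Implicit Types (I : idealr {mpoly K[n]}) (G H : {fset 'X_{1..n}}).

Definition monomials_in (S : 'X_{1..n} -> Prop) (f : {mpoly K[n]}) : Prop :=
  exists2 m, S m & f = 'X_[m].

Definition monomial_ideal I : Prop :=
  exists S, generates (monomials_in S) I.

(* By Dickson's lemma the minimal generating set is finite, so a finite G is no
   restriction. *)
Definition minimal_generators I G : Prop :=
  generates (monomials_in (fun m => m \in G)) I /\
  forall H, (H `<` G)%fset ->
    ~ generates (monomials_in (fun m => m \in H)) I.

(* For m : 'X_{1..n}, m k is the exponent of x_k in the monomial m. *)
Definition dominant I : Prop :=
  exists2 G, minimal_generators I G &
    forall m, m \in G -> exists k, forall m', m' \in G -> m' != m ->
      (m' k < m k)%N.

Definition complete_intersection I : Prop :=
  exists2 G, minimal_generators I G & height I #|` G|.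

End MonomialIdeals.

(* Main.v *)
(* Write P_S for the prime generated by the variables in S, and let q = #|G(I)|.

   Every associated prime of a monomial ideal I is some P_S = (I : u) with u a
   monomial, and sending x_i in S to a generator that divides x_i u but not u is
   injective; hence |S| <= q, and height I = q forces |S| = q. Conversely, if I
   is dominant, dividing the lcm of G(I) by one dominant variable per generator
   yields an associated prime of height exactly q, while every prime containing
   I contains an associated prime P_S; so unmixedness forces height I = q.

   If R/I is Cohen-Macaulay, localize at (x_1, ..., x_n): in a Noetherian local
   ring a regular sequence of length d can be turned into a chain of d + 1 primes
   starting at any given associated prime, so d + |S| <= n for every associated
   P_S, and the chain P_S < ... < (x_1, ..., x_n) gives the reverse inequality.

   If height I = q, the generators are pairwise coprime. After a shear
   x_i |-> x_i + x_(t i) their leading monomials are pure powers of q distinct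
   variables. By Zariski's lemma a maximal ideal contains a univariate monic
   polynomial in each of the n - q remaining sheared variables; by Buchberger's
   coprimality criterion these form a regular sequence modulo I of length
   n - q. No longer one exists, and n - q is the dimension of every localization,
   because a chain of primes starting above P_S has length at most n - |S|. *)

Require Import Defs.
From HB Require Import structures.
From mathcomp Require Import all_boot all_order all_algebra finmap ring zify.
From mathcomp Require Import ring_quotient generic_quotient mpoly boolp.

Set Implicit Arguments.
Unset Strict Implicit.
Unset Printing Implicit Defensive.

Import Order.TTheory GRing.Theory.
Local Open Scope ring_scope.

(** * Ideals, associated primes and regular sequences *)

Section Ideals.
Variable A : comNzRingType.
Implicit Types (J : A -> Prop) (s : seq A).

(* Unlike [idealr], this notion includes the unit ideal. *)
Record is_ideal J : Prop := IsIdeal {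
  is_ideal0 : J 0;
  is_idealD : forall x y, J x -> J y -> J (x + y);
  is_idealM : forall a x, J x -> J (a * x) }.

Lemma is_idealMr J a x : is_ideal J -> J x -> J (x * a).
Proof. by move=> iJ Jx; rewrite mulrC; apply: is_idealM. Qed.

Lemma is_idealB J x y : is_ideal J -> J x -> J y -> J (x - y).
Proof.
by move=> iJ Jx Jy; apply: is_idealD => //; rewrite -mulN1r; apply: is_idealM.
Qed.

Lemma is_ideal_sum J (T : Type) (r : seq T) (Q : pred T) (F : T -> A) :
  is_ideal J -> (forall i, Q i -> J (F i)) -> J (\sum_(i <- r | Q i) F i).
Proof.
move=> iJ JF; elim/big_ind: _ => //; first exact: is_ideal0.
by move=> x y; apply: is_idealD.
Qed.

Lemma is_ideal_idealr (I : idealr A) : is_ideal (fun x => x \in I).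
Proof.
by split=> [|x y|a x]; [apply: idealr0 | apply: rpredD | apply: idealMr].
Qed.

Lemma is_ideal_colon J u : is_ideal J -> is_ideal (fun a => J (a * u)).
Proof.
move=> iJ; split=> [|x y Jx Jy|a x Jx]; first by rewrite mul0r; case: iJ.
- by rewrite mulrDl; apply: is_idealD.
- by rewrite -mulrA; apply: is_idealM.
Qed.

Lemma is_ideal_gen (S : A -> Prop) : is_ideal (ideal_gen S).
Proof.
split.
- by exists [::], (fun=> 0); split=> //; rewrite big_ord0.
- move=> _ _ [s [c [sS ->]]] [t [d [tS ->]]].
  exists (s ++ t), (fun i => if (i < size s)%N then c i else d (i - size s)%N).
  split=> [g|]; first by rewrite mem_cat => /orP[/sS|/tS].
  rewrite size_cat big_split_ord /=; congr (_ + _); apply: eq_bigr => i _.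
  + by rewrite ltn_ord nth_cat ltn_ord.
  + by rewrite ltnNge leq_addr /= nth_cat ltnNge leq_addr /= addKn.
- move=> a _ [s [c [sS ->]]]; exists s, (fun i => a * c i); split=> //.
  by rewrite mulr_sumr; apply: eq_bigr => i _; rewrite mulrA.
Qed.

Lemma mem_ideal_gen (S : A -> Prop) x : S x -> ideal_gen S x.
Proof.
move=> Sx; exists [:: x], (fun=> 1); split=> [g|]; first by rewrite inE => /eqP->.
by rewrite big_ord1 mul1r.
Qed.

Lemma ideal_gen_min (S : A -> Prop) J :
  is_ideal J -> (forall x, S x -> J x) -> forall x, ideal_gen S x -> J x.
Proof.
move=> iJ SJ _ [s [c [sS ->]]]; apply: is_ideal_sum => // i _.
by apply: is_idealM => //; apply/SJ/sS/mem_nth.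
Qed.

Lemma ideal_gen_sub (S T : A -> Prop) :
  (forall x, S x -> T x) -> forall x, ideal_gen S x -> ideal_gen T x.
Proof.
move=> ST; apply: ideal_gen_min (is_ideal_gen T) _ => x /ST.
exact: mem_ideal_gen.
Qed.

Lemma is_idealDM J b : is_ideal J ->
  is_ideal (fun x => exists2 j, J j & exists a, x = j + a * b).
Proof.
move=> iJ; split.
- by exists 0; [case: iJ | exists 0; rewrite mul0r addr0].
- move=> _ _ [j Jj [a ->]] [k Jk [c ->]]; exists (j + k); first exact: is_idealD.
  by exists (a + c); rewrite mulrDl addrACA.
- move=> d _ [j Jj [a ->]]; exists (d * j); first exact: is_idealM.
  by exists (d * a); rewrite mulrDr mulrA.
Qed.

Lemma ideal_gen_rcons s b x :
  ideal_gen (fun g => g \in rcons s b) x <->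
  exists2 j, ideal_gen (fun g => g \in s) j & exists a, x = j + a * b.
Proof.
split.
  apply: (ideal_gen_min (is_idealDM b (is_ideal_gen (fun g => g \in s)))) => y.
  rewrite mem_rcons inE => /orP[/eqP->|ys].
  - by exists 0; [case: (is_ideal_gen (fun g => g \in s)) |
      exists 1; rewrite mul1r add0r].
  - by exists y; [apply: mem_ideal_gen | exists 0; rewrite mul0r addr0].
move=> [j sj [a ->]]; apply: is_idealD; first exact: is_ideal_gen.
- by apply: ideal_gen_sub sj => y ys; rewrite mem_rcons inE ys orbT.
- apply: is_idealM; first exact: is_ideal_gen.
  by apply: mem_ideal_gen; rewrite mem_rcons mem_head.
Qed.

Lemma idealr_of_Prop J : is_ideal J -> ~ J 1 ->
  exists I : idealr A, forall x, x \in I <-> J x.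
Proof.
move=> iJ J1; pose S : A -> bool := fun x => `[< J x >].
have Sc : idealr_closed S.
  split; first by apply/asboolP; case: iJ.
  - by apply/asboolPn.
  - move=> a u v /asboolP Ju /asboolP Jv; apply/asboolP.
    by apply: is_idealD => //; apply: is_idealM.
pose I : idealr A := HB.pack_for (idealr A) S (isIdealr.Build A S Sc).
by exists I => x; split=> [/asboolP|Jx] //; apply/asboolP.
Qed.

Lemma prime_idealr_of_Prop J : is_ideal J -> ~ J 1 ->
  (forall x y, J (x * y) -> J x \/ J y) ->
  exists P : prime_idealr A, forall x, x \in P <-> J x.
Proof.
move=> iJ J1 pJ; pose S : A -> bool := fun x => `[< J x >].
have Sc : idealr_closed S.
  split; first by apply/asboolP; case: iJ.
  - by apply/asboolPn.
  - move=> a u v /asboolP Ju /asboolP Jv; apply/asboolP.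
    by apply: is_idealD => //; apply: is_idealM.
have Sp : prime_idealr_closed S.
  by move=> u v /asboolP/pJ[] h; apply/orP; [left|right]; apply/asboolP.
pose P : prime_idealr A := HB.pack_for (prime_idealr A) S
  (isIdealr.Build A S Sc) (isPrimeIdealrClosed.Build A S Sp).
by exists P => x; split=> [/asboolP|Jx] //; apply/asboolP.
Qed.

Lemma prime_expr (P : prime_idealr A) a k : a ^+ k \in P -> a \in P.
Proof.
elim: k => [|k IH]; first by rewrite expr0 idealr1.
by rewrite exprS prime_idealrM => /orP[|/IH].
Qed.

(** Stated for [is_ideal], so that colon ideals and preimages need no proof of properness. *)
Definition ascending_chain_condition : Prop :=
  forall J : nat -> A -> Prop, (forall k, is_ideal (J k)) ->
  (forall k x, J k x -> J k.+1 x) ->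
  exists k, forall m x, J m x -> J k x.

Lemma acc_noetherian : ascending_chain_condition -> noetherian A.
Proof.
move=> acc I; apply: contrapT => nfg.
have /choice[f fP] : forall s, exists x, {subset s <= I} ->
    x \in I /\ ~ ideal_gen (fun g => g \in s) x.
  move=> s; apply: contrapT => /forallNP h; apply: nfg; exists s => x; split.
  - by move=> xI; apply: contrapT => nx; apply: (h x).
  - apply: ideal_gen_min (is_ideal_idealr I) _ x.
    apply: contrapT => /existsNP[y nys]; apply: (h 0) => sI; case: nys.
    exact: sI.
pose s := fix s k := if k is k'.+1 then rcons (s k') (f (s k')) else [::].
have sI k : {subset s k <= I}.
  elim: k => [|k IH] //= x; rewrite mem_rcons inE => /orP[/eqP->|/IH] //.
  by have [] := fP _ IH.
have [|k x kx|k km] := acc (fun k => ideal_gen (fun g => g \in s k)).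
- by move=> k; apply: is_ideal_gen.
- by apply: ideal_gen_sub kx => y; rewrite /= mem_rcons inE => ->; rewrite orbT.
have [_ []] := fP _ (sI k); apply: (km k.+1).
by apply: mem_ideal_gen; rewrite /= mem_rcons mem_head.
Qed.

(* A colon ideal [J : w] that is maximal among the [J : c v] is prime. *)
Lemma associated_above J v : ascending_chain_condition -> is_ideal J -> ~ J v ->
  exists w (P : prime_idealr A), (forall a, a \in P <-> J (a * w)) /\
    forall a, J (a * v) -> a \in P.
Proof.
move=> acc iJ Jv.
suff [c [Jcv cmax]] : exists c, ~ J (c * v) /\ forall d, ~ J (d * (c * v)) ->
    forall a, J (a * (d * (c * v))) -> J (a * (c * v)).
  have [||x y Jxy|P PE] := @prime_idealr_of_Prop (fun a => J (a * (c * v))).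
  - exact: is_ideal_colon.
  - by rewrite mul1r.
  - case: (pselect (J (y * (c * v)))) => Jy; first by right.
    by left; apply: (cmax y) => //; rewrite mulrA.
  exists (c * v), P; split=> // a Jav; apply/PE.
  by rewrite mulrCA; apply: is_idealM.
apply: contrapT => /forallNP nmax.
have /choice[f fP] : forall c, exists d, ~ J (c * v) ->
    ~ J (d * (c * v)) /\ exists2 a, J (a * (d * (c * v))) & ~ J (a * (c * v)).
  move=> c; case: (pselect (J (c * v))) => [Jc|Jc]; first by exists 0.
  apply: contrapT => /forallNP nd; apply: (nmax c); split=> // d Jd a Ja.
  apply: contrapT => Jac; apply: (nd d) => _; split=> //; by exists a.
pose c := fix c k := if k is k'.+1 then f (c k') * c k' else 1.
have Jc k : ~ J (c k * v).
  elim: k => [|k IH] /=; first by rewrite mul1r.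
  by rewrite -mulrA; case: (fP _ IH).
have [|k a Ja|k km] := acc (fun k a => J (a * (c k * v))).
- by move=> k; apply: is_ideal_colon.
- by rewrite /= -mulrA mulrCA; apply: is_idealM.
have [_ [a Ja]] := fP _ (Jc k); case; apply: (km k.+1).
by rewrite /= -mulrA.
Qed.

(* If every v killed by P modulo J were a multiple of x modulo J, dividing u
   repeatedly by x would give a strictly ascending chain of ideals. *)
Lemma associated_step J x u (P : prime_idealr A) :
  ascending_chain_condition -> is_ideal J ->
  (forall a, exists b, b * (1 - a * x) = 1) ->
  (forall b, J (x * b) -> J b) ->
  (forall a, a \in P <-> J (a * u)) ->
  exists w (Q : prime_idealr A),
    (forall a, a \in Q <-> exists2 j, J j & exists b, a * w = j + b * x) /\
    {subset P <= Q} /\ ~ {subset Q <= P}.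
Proof.
move=> acc iJ ux xreg PE.
have nJu : ~ J u by move=> Ju; have := idealr1 P; rewrite (PE 1).2 ?mul1r.
pose Jx y := exists2 j, J j & exists b, y = j + b * x.
have iJx : is_ideal Jx by apply: is_idealDM.
(* The prime that [associated_above] produces from such a v contains P and x, whereas x is outside P
   because it is regular modulo J. *)
suff [v Pv nv] : exists2 v, (forall a, a \in P -> J (a * v)) & ~ Jx v.
  have [w [Q [QE Qv]]] := associated_above acc iJx nv.
  exists w, Q; split=> //; split.
    move=> a aP; apply: Qv; exists (a * v); first exact: Pv.
    by exists 0; rewrite mul0r addr0.
  have xQ : x \in Q.
    by apply/QE; exists 0; [case: iJ | exists w; rewrite add0r mulrC].
  by move=> /(_ x xQ) /PE/xreg.
apply: contrapT => /forall2NP nv.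
have /choice[f fP] : forall v, exists w, (forall a, a \in P -> J (a * v)) ->
    J (v - w * x).
  move=> v; case: (nv v) => [|/contrapT[j Jj [b ->]]]; last first.
    by exists b; rewrite addrK.
  by move=> nP; exists 0 => /nP.
pose v := fix v k := if k is k'.+1 then f (v k') else u.
have vP k a : a \in P -> J (a * v k).
  elim: k a => [|k IH] a aP /=; first exact/PE.
  apply: xreg; have -> : x * (a * f (v k)) = a * v k - a * (v k - f (v k) * x).
    by ring.
  apply: is_idealB => //; first exact: IH.
  by apply: is_idealM => //; apply: fP => b; apply: IH.
have vE k : J (v k - v k.+1 * x) by apply: fP; apply: vP.
have nJv k : ~ J (v k).
  elim: k => //= k IH Jv; apply: IH; rewrite -[v k](subrK (v k.+1 * x)).
  by apply: is_idealD => //; apply: is_idealMr.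
have [|k y [j Jj [a ->]]|k km] :=
  acc (fun k y => exists2 j, J j & exists a, y = j + a * v k).
- by move=> k; apply: is_idealDM.
- exists (j + a * (v k - v k.+1 * x)).
    by apply: is_idealD => //; apply: is_idealM.
  by exists (a * x); ring.
(* Stabilisation gives v (k+1) = a v k modulo J, while v k = x v (k+1) modulo J. Hence (1 - a x) v
   (k+1) is in J, and 1 - a x is invertible. *)
have [|j Jj [a E]] := km k.+1 (v k.+1).
  by exists 0; [case: iJ | exists 1; rewrite mul1r add0r].
apply: (nJv k.+1); have [b bE] := ux a.
rewrite -[v k.+1]mul1r -bE -mulrA; apply: is_idealM => //.
have -> : (1 - a * x) * v k.+1 =
  (v k.+1 - a * v k) + a * (v k - v k.+1 * x) by ring.
apply: is_idealD => //; last exact: is_idealM.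
by rewrite {1}E addrK.
Qed.

(** Each further element of [s] leads, by [associated_step], to a strictly larger prime associated
    to the ideal of one more element. The induction carries the witness w that makes the current
    prime a colon ideal. *)
Lemma regular_seq_chain s u (P : prime_idealr A) :
  ascending_chain_condition ->
  (forall x, x \in s -> forall a, exists b, b * (1 - a * x) = 1) ->
  regular_seq s -> (forall a, a \in P <-> a * u = 0) ->
  exists p, prime_chain (size s) p /\ p 0 = P.
Proof.
move=> acc us [sreg _] PE.
suff [p [pc [p0 _]]] : exists p, prime_chain (size s) p /\ p 0 = P /\
    exists w, forall a, a \in p (size s) <->
      ideal_gen (fun g => g \in take (size s) s) (a * w) by exists p.
have := leqnn (size s); move: {-2}(size s) => k.
elim: k => [_|k IH ks].
  exists (fun=> P); split=> //; split=> //; exists u => a.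
  rewrite PE take0; split=> [->|]; first by case: (is_ideal_gen (fun g => g \in [::])).
  case=> -[|y t] [c [tS ->]]; first by rewrite big_ord0.
  by have := tS y (mem_head _ _).
have [p [pc [p0 [w wE]]]] := IH (ltnW ks).
have [w' [Q [QE [PQ QP]]]] := associated_step acc (is_ideal_gen _)
  (us _ (mem_nth 0 ks)) (sreg _ ks) wE.
exists (fun i => if (i <= k)%N then p i else Q); split; last split=> //.
- move=> i; rewrite ltnS leq_eqVlt => /orP[/eqP->|ik].
  + by rewrite eqxx ltnn.
  + by rewrite ik orbT; apply: pc.
- rewrite /= ltnn (take_nth 0) //; exists w' => a.
  by rewrite QE ideal_gen_rcons.
Qed.

Lemma acc_associated_zero : ascending_chain_condition ->
  exists u (P : prime_idealr A), forall a, a \in P <-> a * u = 0.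
Proof.
move=> acc; have [|/eqP|w [P [PE _]]] := @associated_above (eq^~ 0) 1 acc.
- by split=> [|x y -> ->|a x ->]; rewrite ?addr0 ?mulr0.
- by rewrite (negbTE (oner_neq0 _)).
by exists w, P.
Qed.

End Ideals.

(** By hypothesis x and f a generate the same ideal of B, so an ideal of B is determined by its
    preimage in A. Quotients and localizations both satisfy this. *)
Lemma acc_transfer (A B : comNzRingType) (f : {rmorphism A -> B}) :
  (forall x, exists a c d, c * x = f a /\ x = d * f a) ->
  ascending_chain_condition A -> ascending_chain_condition B.
Proof.
move=> fP acc J iJ Jinc; have [|k a Ja|k km] := acc (fun k a => J k (f a)).
- move=> k; split=> [|x y|a x]; rewrite ?(rmorph0, rmorphD, rmorphM).
  + exact: is_ideal0.
  + exact: is_idealD.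
  + exact: is_idealM.
- exact: Jinc.
exists k => m x Jx; have [a [c [d [cx ->]]]] := fP x.
by apply: is_idealM => //; apply: (km m); rewrite -cx; apply: is_idealM.
Qed.

Section QuotientMap.
Variables (A : comNzRingType) (I : idealr A).
Local Open Scope quotient_scope.

Definition quot_map : {rmorphism A -> {ideal_quot I}} := \pi_{ideal_quot I}.

Lemma quot_map_eq0 a : quot_map a = 0 <-> a \in I.
Proof.
rewrite -(rmorph0 quot_map) -[X in X \in I]subr0 Quotient.idealrBE.
by split=> /eqP.
Qed.

Lemma quot_map_surj u : exists a, u = quot_map a.
Proof. by exists (repr u); rewrite /quot_map /= reprK. Qed.

Lemma associated_primeP (P : prime_idealr A) :
  associated_prime I P <-> exists f, forall a, a \in P <-> a * f \in I.
Proof.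
split=> [[u uP]|[f fP]].
  have [f uf] := quot_map_surj u; exists f => a.
  by rewrite uP -quot_map_eq0 rmorphM uf.
by exists (quot_map f) => a; rewrite fP -quot_map_eq0 rmorphM.
Qed.

End QuotientMap.

(** * Primes generated by variables, and the dimension of K[x_1, ..., x_n] *)

Section VariableIdeals.
Variables (K : fieldType) (n : nat).
Local Notation R := {mpoly K[n]}.
Implicit Types (S : {set 'I_n}) (m : 'X_{1..n}) (f : R).

Definition hits S m := [exists i in S, m i != 0%N].

Lemma hitsP S m : reflect (exists2 i, i \in S & m i != 0%N) (hits S m).
Proof. exact: exists_inP. Qed.

Definition kill_vars S f : R := f \mPo [tuple if i \in S then 0 else 'X_i | i < n].

Lemma kill_varsX S m : kill_vars S 'X_[m] = if hits S m then 0 else 'X_[m].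
Proof.
rewrite /kill_vars comp_mpolyX; case: ifPn => [/hitsP[i iS mi]|].
  by rewrite (bigD1 i) //= tnth_mktuple iS expr0n (negbTE mi) mul0r.
move=> /exists_inPn nS; rewrite [RHS]mpolyXE_id; apply: eq_bigr => i _.
rewrite tnth_mktuple; case: ifP => // /nS; rewrite negbK => /eqP->.
by rewrite !expr0.
Qed.

(** As the kernel of an endomorphism of a domain, P_S is prime at once; [in_var_prime] recovers its
    description by monomials. *)
Definition var_ideal S : pred R := fun f => kill_vars S f == 0.

Lemma var_ideal_closed S : idealr_closed (var_ideal S).
Proof.
split.
- by apply/eqP; rewrite /kill_vars rmorph0.
- by apply/eqP; rewrite /kill_vars rmorph1; apply/eqP/oner_neq0.
- move=> a u v /eqP u0 /eqP v0; apply/eqP; move: u0 v0; rewrite /kill_vars.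
  by rewrite rmorphD rmorphM /= => -> ->; rewrite mulr0 addr0.
Qed.

Lemma var_ideal_prime S : prime_idealr_closed (var_ideal S).
Proof.
move=> u v /eqP; rewrite /kill_vars rmorphM /= => /eqP.
by rewrite mulf_eq0 => /orP[] h; apply/orP; [left|right].
Qed.

HB.instance Definition _ S :=
  isIdealr.Build R (var_ideal S) (var_ideal_closed S).
HB.instance Definition _ S :=
  isPrimeIdealrClosed.Build R (var_ideal S) (@var_ideal_prime S).

Definition var_prime S : prime_idealr R := var_ideal S.

Lemma mcoeff_kill_vars S f m :
  (kill_vars S f)@_m = if hits S m then 0 else f@_m.
Proof.
rewrite /kill_vars comp_mpolyEX raddf_sum /=.
under eq_bigr => m' _ do
  rewrite mcoeffZ -/(kill_vars S _) kill_varsX (fun_if (mcoeff m)) mcoeff0 mcoeffX.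
have [mS|mS] := boolP (hits S m).
  apply: big1_seq => m' _; case: ifPn => [_|]; first by rewrite mulr0.
  by case: eqP => [->|_ _]; rewrite ?mS ?mulr0.
have [mf|mf] := boolP (m \in msupp f).
  rewrite (bigD1_seq m) ?msupp_uniq //= (negbTE mS) eqxx mulr1 big1 ?addr0 //.
  by move=> m' /negbTE->; case: ifP; rewrite mulr0.
rewrite (memN_msupp_eq0 mf); apply: big1_seq => m' /andP[_ m'f].
case: eqP => [E|_]; last by case: ifP; rewrite mulr0.
by rewrite E (negbTE mf) in m'f.
Qed.

Lemma in_var_prime S f :
  reflect (forall m, m \in msupp f -> hits S m) (f \in var_prime S).
Proof.
apply: (iffP eqP) => [f0 m|fS].
  rewrite mcoeff_msupp; apply: contraR => mS.
  by have := congr1 (mcoeff m) f0; rewrite mcoeff_kill_vars (negbTE mS) mcoeff0 => ->.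
apply/mpolyP => m; rewrite mcoeff_kill_vars mcoeff0; case: ifPn => // mS.
by apply: memN_msupp_eq0; apply: contra mS; apply: fS.
Qed.

Lemma mpolyX_in_var_prime S m : ('X_[m] \in var_prime S) = hits S m.
Proof.
apply/in_var_prime/idP => [|mS m']; first by apply; rewrite msuppX mem_head.
by rewrite msuppX inE => /eqP->.
Qed.

Lemma var_in_var_prime S i : ('X_i \in var_prime S) = (i \in S).
Proof.
rewrite mpolyX_in_var_prime; apply/hitsP/idP => [[j jS]|iS].
  by rewrite mnm1E; case: (i =P j) => [->|].
by exists i; rewrite ?mnm1E ?eqxx.
Qed.

Lemma mpolyX_divides m m' : (m <= m')%MM ->
  exists b : R, 'X_[m'] = b * 'X_[m].
Proof. by move=> mm'; exists 'X_[m' - m]; rewrite -mpolyXD submK. Qed.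

Lemma idealrZ (I : idealr R) c f : f \in I -> c *: f \in I.
Proof. by rewrite -mul_mpolyC; apply: idealMr. Qed.

Lemma mem_idealr_msupp (I : idealr R) f :
  (forall m, m \in msupp f -> 'X_[m] \in I) -> f \in I.
Proof.
move=> fI; rewrite [f]mpolyE big_seq; apply: rpred_sum => m /fI.
exact: idealrZ.
Qed.

Lemma var_prime_sub (I : idealr R) S :
  (forall i, i \in S -> 'X_i \in I) -> {subset var_prime S <= I}.
Proof.
move=> SI f /in_var_prime fS; apply: mem_idealr_msupp => m /fS /hitsP[i iS mi].
have [|b ->] := @mpolyX_divides U_(i)%MM m; first by rewrite lep1mP.
exact/idealMr/SI.
Qed.

Lemma var_prime_subset S (T : {set 'I_n}) : S \subset T ->
  {subset var_prime S <= var_prime T}.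
Proof.
move=> ST; apply: var_prime_sub => i iS.
by rewrite var_in_var_prime (subsetP ST).
Qed.

Lemma var_in_prime (P : prime_idealr R) m : 'X_[m] \in P ->
  exists2 i, 'X_i \in P & m i != 0%N.
Proof.
rewrite mpolyXE_id => mP; apply: contrapT => /forall2NP nP.
suff : \prod_(i < n) ('X_i : R) ^+ m i \notin P by rewrite mP.
elim/big_ind: _ => [|x y xP yP|i _]; first by rewrite idealr1.
- by rewrite prime_idealrM negb_or xP.
case: (nP i) => [iP|/negP]; first by apply/negP => /prime_expr.
by rewrite negbK => /eqP->; rewrite expr0 idealr1.
Qed.

End VariableIdeals.

(** * Chains of primes and algebraic dependence *)

Section Dimension.
Variables (K : fieldType) (n : nat).
Local Notation R := {mpoly K[n]}.
Implicit Types (S : {set 'I_n}) (y : nat -> R) (p : nat -> prime_idealr R).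

(** Factor out the power of x in front of the first nonzero T a. That power is outside P, and the
    other factor equals T a modulo x, so it is outside Q and hence outside P. *)
Lemma horner_notin (P Q : prime_idealr R) (x : R) N (T : nat -> R) :
  {subset P <= Q} -> x \in Q -> x \notin P ->
  (forall a, T a = 0 \/ T a \notin Q) -> (exists2 a, (a < N)%N & T a \notin Q) ->
  \sum_(a < N) x ^+ a * T a \notin P.
Proof.
move=> PQ xQ xP; elim: N T => [|N IH] T TQ [a aN Ta] //.
rewrite big_ord_recl expr0 mul1r /=.
under eq_bigr => i _ do rewrite /bump leq0n add1n exprS -mulrA.
rewrite -mulr_sumr; case: (TQ 0%N) => [T0|T0].
  rewrite T0 add0r prime_idealrM negb_or xP /=; apply: (IH (fun a => T a.+1)) => //.
  by case: a aN Ta => [|a] aN Ta; [rewrite T0 idealr0 in Ta | exists a].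
apply: contra T0 => /PQ h; rewrite -[T 0%N](addrK (x * \sum_(i < N) x ^+ i * T i.+1)).
by apply: rpredB => //; rewrite mulrC idealMr.
Qed.

(* The exponents of y_0, ..., y_(d-1) are the base N digits of k, so that the
   lexicographic order on monomials is the order of the natural numbers. *)
Fixpoint digit_monomial N y d k : R :=
  if d is d'.+1 then
    y 0%N ^+ (k %/ N ^ d')%N * digit_monomial N (y \o succn) d' (k %% N ^ d')%N
  else 1.

Lemma sum_digit (F : nat -> R) N d :
  \sum_(k < N * d) F k = \sum_(a < N) \sum_(b < d) F (a * d + b)%N.
Proof.
elim: N => [|N IH]; first by rewrite mul0n !big_ord0.
by rewrite big_ord_recr /= -IH mulSnr big_split_ord.
Qed.

(** Read the sum as a polynomial in y 0 whose coefficients are digit sums in the later y i. By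
    induction along the chain from p 1, each coefficient is 0 or outside p 1, and [horner_notin]
    applies. *)
Lemma digit_sum_notin N y d p (c : nat -> K) :
  prime_chain d p -> (forall i, (i < d)%N -> y i \in p i.+1 /\ y i \notin p i) ->
  (exists2 k, (k < N ^ d)%N & c k != 0) ->
  \sum_(k < N ^ d) c k *: digit_monomial N y d k \notin p 0%N.
Proof.
elim: d y p c => [|d IH] y p c pc yp [k kN ck].
  move: kN ck; rewrite expn0 ltnS leqn0 big_ord1 => /eqP-> c0 /=.
  apply: contraFN (idealr1 (p 0%N)) => h.
  by rewrite -[1](scalerK c0); apply: idealrZ.
rewrite expnS (sum_digit (fun k => c k *: digit_monomial N y d.+1 k)) /=.
have Nd : (0 < N ^ d)%N.
  by move: kN; rewrite expnS; case: (N ^ d)%N => //; rewrite muln0.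
pose T a := \sum_(b < N ^ d) c (a * N ^ d + b)%N *: digit_monomial N (y \o succn) d b.
rewrite (eq_bigr (fun a : 'I_N => y 0%N ^+ a * T a)); last first.
  move=> a _; rewrite mulr_sumr; apply: eq_bigr => b _.
  by rewrite divnMDl // divn_small // addn0 modnMDl modn_small // scalerAr.
have [p01 np10] := pc 0%N isT; have [y1 y0] := yp 0%N isT.
have Tn a : (exists2 b, (b < N ^ d)%N & c (a * N ^ d + b)%N != 0) ->
    T a \notin p 1%N.
  move=> h.
  apply: (IH (y \o succn) (p \o succn) (fun b => c (a * N ^ d + b)%N)) => // i id.
    exact: pc.
  exact: yp.
apply: horner_notin p01 y1 y0 _ _ => [a|].
  case: (pselect (exists2 b, (b < N ^ d)%N & c (a * N ^ d + b)%N != 0)) => h.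
    by right; apply: Tn.
  left; apply: big1 => b _; case: (eqVneq (c (a * N ^ d + b)%N) 0) => [->|cb].
    by rewrite scale0r.
  by case: h; exists b.
exists (k %/ N ^ d)%N; first by rewrite ltn_divLR // -expnS.
by apply: Tn; exists (k %% N ^ d)%N; rewrite ?ltn_mod // -divn_eq.
Qed.

Lemma mdeg_mlead_digit_monomial N y d D k : (0 < N)%N ->
  (forall i, (i < d)%N -> (mdeg (mlead (y i)) <= D)%N) -> (k < N ^ d)%N ->
  (mdeg (mlead (digit_monomial N y d k)) <= d * (D * N))%N.
Proof.
move=> N0; elim: d y k => [|d IH] y k yD kN /=; first by rewrite mlead1 mdeg0.
have Nd : (0 < N ^ d)%N by rewrite expn_gt0 N0.
apply: leq_trans (lemc_mdeg (mleadM_le _ _)) _; rewrite mdegD mulSn leq_add //.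
  apply: leq_trans (lemc_mdeg (mleadX_le _ _)) _; rewrite mdegMn.
  by rewrite leq_mul ?yD // ltnW // ltn_divLR // -expnS.
by apply: IH => [i|]; [apply: (yD i.+1) | rewrite ltn_mod].
Qed.

Lemma left_kernel_nontrivial q r (M : 'M[K]_(q, r)) : (r < q)%N ->
  exists2 u : 'rV[K]_q, u != 0 & u *m M = 0.
Proof.
move=> rq; have : kermx M != 0.
  rewrite kermx_eq0 /row_free; apply: contraTneq rq => E.
  by rewrite -leqNgt -E rank_leq_col.
move=> /rowV0Pn[u uM u0]; exists u => //.
by apply/sub_kermxP.
Qed.

(** Modulo P_S only n - #|S| variables survive, so for a suitable N the digit monomials outnumber
    the monomials they can involve, and linear algebra gives a relation. *)
Lemma alg_dependent S y : exists N (c : nat -> K),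
  (exists2 k, (k < N ^ (n - #|S|).+1)%N & c k != 0) /\
  \sum_(k < N ^ (n - #|S|).+1) c k *: digit_monomial N y (n - #|S|).+1 k
    \in var_prime K S.
Proof.
set e := (n - #|S|)%N; set d := e.+1.
pose D := (\max_(i < d) mdeg (mlead (y i)))%N.
(* B bounds the degrees of the digit monomials, and N > (d D + 1)^e gives (B + 1)^e <= ((d D + 1)
   N)^e < N^(e + 1). *)
pose N := (((d * D).+1) ^ e).+1; pose B := (d * (D * N))%N.
pose T := {ffun {i : 'I_n | i \notin S} -> 'I_B.+1}.
have cT : (#|{: T}| < N ^ d)%N.
  rewrite card_ffun card_sig card_ord.
  have -> : #|[pred i | i \notin S]| = e.
    rewrite /e -[X in (X - _)%N]card_ord -(cardsC S) addKn.
    by apply: eq_card => i; rewrite !inE.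
  apply: (@leq_ltn_trans (((d * D).+1 * N) ^ e)%N).
    have [->|e0] := posnP e; first by rewrite !expn0.
    by rewrite leq_exp2r // /B mulnA [X in (_ <= X)%N]mulSn -add1n leq_add2r.
  by rewrite expnMn expnS ltn_pmul2r ?expn_gt0.
pose mon (t : T) : 'X_{1..n} :=
  [multinom if insub i is Some j then val (t j) else 0%N | i < n].
pose M := \matrix_(k < N ^ d, j < #|{: T}|)
  (digit_monomial N y d k)@_(mon (enum_val j)).
have [u u0 uM] := left_kernel_nontrivial M cT.
have [k uk] : exists k, u 0 k != 0.
  apply/existsP; apply: contraNT u0 => /existsPn u0; apply/eqP/rowP => k.
  by have := u0 k; rewrite mxE negbK => /eqP.
pose c k := if insub k is Some k' then u 0 k' else 0.
have cE (k' : 'I_(N ^ d)) : c k' = u 0 k' by rewrite /c valK.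
exists N, c; split; first by exists k; rewrite ?cE.
apply/in_var_prime => m; apply: contraTT => mS; rewrite mcoeff_msupp negbK.
have mnotS i : i \in S -> m i = 0%N.
  by move=> iS; apply/eqP; apply: contraNT mS => mi; apply/hitsP; exists i.
have [mB|Bm] := leqP (mdeg m) B; last first.
  rewrite raddf_sum big1 //= => k' _; rewrite mcoeffZ memN_msupp_eq0 ?mulr0 //.
  apply: contraL Bm => /msupp_le_mlead/lemc_mdeg h; rewrite -leqNgt.
  apply: leq_trans h _; apply: mdeg_mlead_digit_monomial => // i id.
  exact: (leq_bigmax (Ordinal id)).
pose t : T := [ffun i => inord (m (val i))].
have -> : m = mon t.
  apply/mnmP => i; rewrite mnmE; case: insubP => [j _ <-|]; last first.
    by rewrite negbK => /mnotS.
  rewrite ffunE /= inordK // ltnS; apply: leq_trans mB.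
  by rewrite mdegE (bigD1 (val j)) //= leq_addr.
move/rowP/(_ (enum_rank t)): uM; rewrite !mxE raddf_sum /= => E.
apply/eqP; rewrite -[RHS]E; apply: eq_bigr => k' _.
by rewrite mcoeffZ cE mxE enum_rankK.
Qed.

(** In a longer chain, elements y i of p (i+1) outside p i would be related modulo P_S by
    [alg_dependent]. As P_S lies in p 0, this contradicts [digit_sum_notin]. *)
Theorem prime_chain_var_bound S d p :
  prime_chain d p -> (forall i, i \in S -> 'X_i \in p 0%N) -> (d + #|S| <= n)%N.
Proof.
move=> pc pS; rewrite leqNgt; apply/negP => nd.
have /choice[y yP] : forall i, exists z, (i < d)%N -> z \in p i.+1 /\ z \notin p i.
  move=> i; case: (ltnP i d) => [id|_]; last by exists 0.
  have [_ np] := pc i id; apply: contrapT => /forallNP ny; apply: np => z zp.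
  by apply: contrapT => /negP zn; apply: (ny z).
have [N [c [c0 cS]]] := alg_dependent S y.
have ed : ((n - #|S|).+1 <= d)%N.
  by have := max_card S; rewrite card_ord; lia.
have/negP[] := digit_sum_notin (fun i h => pc i (leq_trans h ed))
  (fun i h => yP i (leq_trans h ed)) c0.
exact: var_prime_sub pS _ cS.
Qed.

End Dimension.

(** * Heights and associated primes of monomial ideals *)

Section Heights.
Variables (K : fieldType) (n : nat).
Local Notation R := {mpoly K[n]}.
Implicit Types (S T : {set 'I_n}) (m g u : 'X_{1..n}) (I : idealr R).

(** The variables are adjoined one at a time, those of [S] first. *)
Lemma var_chain_through S : exists p : nat -> prime_idealr R,
  [/\ prime_chain n p, p #|S| = var_prime K S & p n = var_prime K setT].
Proof.
pose s := enum S ++ enum (~: S).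
have us : uniq s.
  rewrite cat_uniq !enum_uniq andbT /=; apply/hasPn => i.
  by rewrite !mem_enum inE.
have ss : size s = n by rewrite size_cat -!cardE cardsC card_ord.
exists (fun k => var_prime K [set i in take k s]); split.
- move=> k kn; split.
    apply: var_prime_subset; apply/subsetP => i; rewrite !inE => h.
    by rewrite (take_nth (Ordinal kn)) ?ss // mem_rcons inE h orbT.
  move=> /(_ 'X_(nth (Ordinal kn) s k)); rewrite !var_in_var_prime !inE.
  rewrite (take_nth (Ordinal kn)) ?ss // mem_rcons mem_head => /(_ isT).
  have := us; rewrite -{1}(cat_take_drop k s) (drop_nth (Ordinal kn)) ?ss //.
  by rewrite cat_uniq /= negb_or => /and3P[_ /andP[/negbTE->]].
- congr var_prime; apply/setP => i; rewrite inE cardE take_size_cat //.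
  by rewrite mem_enum.
- congr var_prime; apply/setP => i; rewrite !inE take_oversize ?ss //.
  by rewrite mem_cat !mem_enum inE orbN.
Qed.

Lemma eq_prime_height (P Q : prime_idealr R) h :
  P =i Q -> prime_height P h -> prime_height Q h.
Proof.
move=> PQ [[p pc pP] hP]; split; first by exists p => // x; rewrite pP PQ.
by move=> d [q qc qQ]; apply: hP; exists q => // x; rewrite qQ PQ.
Qed.

Lemma height_ge_sub (P Q : prime_idealr R) d :
  {subset P <= Q} -> height_ge P d -> height_ge Q d.
Proof.
move=> PQ [p pc pP]; exists (fun i => if (i < d)%N then p i else Q); last first.
  by rewrite ltnn.
move=> i id; rewrite id; have [pi npi] := pc i id.
have [_|di] := ltnP i.+1 d; first exact: pc.
have E : i.+1 = d by apply/eqP; rewrite eqn_leq id.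
rewrite E in pi npi; split=> [x /pi|Qi]; first by rewrite pP => /PQ.
by apply: npi => x; rewrite pP => /PQ/Qi.
Qed.

Lemma prime_height_var_prime S : prime_height (var_prime K S) #|S|.
Proof.
have Sn : (#|S| <= n)%N by have := max_card S; rewrite card_ord.
have [p [pc pS pn]] := var_chain_through S; split.
  exists p; first by move=> i iS; apply: pc; apply: leq_trans Sn.
  by rewrite pS.
move=> d [q qc qS].
(* A chain ending at P_S is prolonged by the n - #|S| steps from P_S to the ideal of all variables;
   the total length is at most n. *)
suff /(prime_chain_var_bound (S := set0)) : prime_chain (d + (n - #|S|))
    (fun i => if (i < d)%N then q i else p (#|S| + (i - d))%N).
  by rewrite cards0 => /(_ (fun i => ltac:(by rewrite inE))); lia.
move=> i id; have [lid|] := ltnP i d.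
  have [qi nqi] := qc i lid; have [_|di] := ltnP i.+1 d; first exact: qc.
  have E : i.+1 = d by apply/eqP; rewrite eqn_leq lid.
  rewrite E subnn addn0 pS; rewrite E in qi nqi.
  by split=> [x /qi|Si]; [rewrite qS | apply: nqi => x; rewrite qS => /Si].
move=> di; rewrite ltnNge (leq_trans di) //= subSn // addnS.
by apply: pc; rewrite -ltn_subRL ltn_subLR.
Qed.

Lemma prime_height_uniq (P : prime_idealr R) h k :
  prime_height P h -> prime_height P k -> h = k.
Proof.
by move=> [Ph hP] [Pk kP]; apply/eqP; rewrite eqn_leq kP ?hP.
Qed.

End Heights.

(** * Associated primes of monomial ideals *)

Section MonomialAssociatedPrimes.
Variables (K : fieldType) (n : nat).
Local Notation R := {mpoly K[n]}.
Implicit Types (S T : {set 'I_n}) (m g u : 'X_{1..n}).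

Variables (I : idealr R) (G : {fset 'X_{1..n}}).
Hypothesis genI : generates (monomials_in (fun m => m \in G)) I.

Lemma mem_generated f :
  f \in I <-> forall m, m \in msupp f -> exists2 g, g \in G & (g <= m)%MM.
Proof.
pose J (h : R) := forall m, m \in msupp h -> exists2 g, g \in G & (g <= m)%MM.
have iJ : is_ideal J.
  split=> [m|x y Jx Jy m /msuppD_le|a x Jx m /msuppM_le/allpairsP[[m1 m2] /=]].
  - by rewrite msupp0.
  - by rewrite mem_cat => /orP[/Jx|/Jy].
  - move=> [_ /Jx[g gG gm] ->]; exists g => //.
    by apply: lepm_trans gm _; apply: lem_addl.
rewrite -/(J f); split=> [/genI|fJ].
  apply: (ideal_gen_min iJ) => _ [m mG ->] m'.
  by rewrite msuppX inE => /eqP->; exists m; rewrite ?lepm_refl.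
apply: mem_idealr_msupp => m /fJ[g gG /(@mpolyX_divides K)[b ->]].
apply: idealMr; apply/genI; apply: mem_ideal_gen; by exists g.
Qed.

Lemma mpolyX_generated m :
  ('X_[m] : R) \in I <-> exists2 g, g \in G & (g <= m)%MM.
Proof.
rewrite mem_generated; split=> [|h m']; first by apply; rewrite msuppX mem_head.
by rewrite msuppX inE => /eqP->.
Qed.

Lemma msupp_generated f m : f \in I -> m \in msupp f -> ('X_[m] : R) \in I.
Proof. by move=> /mem_generated h /h /mpolyX_generated. Qed.

Lemma generator_neq0 g : g \in G -> g != 0%MM.
Proof.
move=> gG; apply/eqP => g0; have := idealr1 I; rewrite -mpolyX0.
suff -> : ('X_[0%MM] : R) \in I by [].
by rewrite -g0; apply/mpolyX_generated; exists g; rewrite ?lepm_refl.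
Qed.

Lemma sub_var_prime S :
  (forall g, g \in G -> hits S g) -> {subset I <= var_prime K S}.
Proof.
move=> GS f /mem_generated fI; apply/in_var_prime => m /fI[g /GS/hitsP[i iS gi]].
move=> /mnm_lepP/(_ i) gm; apply/hitsP; exists i => //.
by rewrite -lt0n (leq_trans _ gm) // lt0n.
Qed.

Lemma prime_hits (P : prime_idealr R) : {subset I <= P} ->
  forall g, g \in G -> hits [set i | 'X_i \in P] g.
Proof.
move=> IP g gG; have /IP/var_in_prime[i iP gi] : ('X_[g] : R) \in I.
  by apply/mpolyX_generated; exists g; rewrite ?lepm_refl.
by apply/hitsP; exists i; rewrite ?inE.
Qed.

(** Once a monomial has exponent at least [B] in x_i, no generator fails to divide it because of
    x_i. *)
Let B := \max_(g <- G) mdeg g.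

Lemma generator_le_bound g i : g \in G -> (g i <= B)%N.
Proof.
move=> gG; apply: leq_trans (leq_bigmax_seq _ gG isT).
by rewrite mdegE (bigD1 i) //= leq_addr.
Qed.

Lemma monomial_remainder (J : idealr R) (f : R) : exists2 f0, f - f0 \in J &
  forall m, m \in msupp f0 -> m \in msupp f /\ ('X_[m] : R) \notin J.
Proof.
pose f0 := \sum_(m <- msupp f | ('X_[m] : R) \notin J) f@_m *: 'X_[m] : R.
have f0E m : f0@_m = if ('X_[m] : R) \in J then 0 else f@_m.
  rewrite /f0 raddf_sum /=; under eq_bigr do rewrite mcoeffZ mcoeffX.
  have [mf|mf] := boolP (m \in msupp f); last first.
    rewrite (memN_msupp_eq0 mf) if_same big1_seq // => m' /andP[_ m'f].
    by case: eqP => [E|_]; rewrite ?mulr0 // -E m'f in mf *.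
  rewrite big_mkcond (bigD1_seq m) ?msupp_uniq //= eqxx mulr1 big1 ?addr0.
    by case: ('X_[m] \in J).
  by move=> m' /negbTE->; rewrite mulr0 if_same.
exists f0 => [|m].
  apply: mem_idealr_msupp => m; rewrite mcoeff_msupp mcoeffB f0E.
  by case: ifP => //; rewrite subrr eqxx.
by rewrite !mcoeff_msupp f0E; case: ifP => [|_ ->] //; rewrite eqxx.
Qed.

(* Multiplying f by a high power of the variables outside P saturates it: a
   monomial of f lies in I as soon as one of its multiples by a monomial in the
   variables outside P does. *)
Lemma associated_prime_monomial (P : prime_idealr R) : associated_prime I P ->
  exists S, P =i var_prime K S /\ exists u, ('X_[u] : R) \notin I /\
    forall i, i \in S -> ('X_[U_(i) + u] : R) \in I.
Proof.
move=> /associated_primeP[f fP]; pose S := [set i | 'X_i \in P].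
have SP : {subset var_prime K S <= P} by apply: var_prime_sub => i; rewrite inE.
pose w : 'X_{1..n} := [multinom if i \in S then 0%N else B | i < n].
have wP : ('X_[w] : R) \notin P.
  by apply/negP => /var_in_prime[i iP]; rewrite mnmE inE iP.
have fwP a : a \in P <-> a * (f * 'X_[w]) \in I.
  rewrite [f * _]mulrC mulrA; split=> [aP|/fP].
    by apply/fP; rewrite mulrC idealMr.
  by rewrite prime_idealrM (negbTE wP) orbF.
have [f0 f0I f0S] := monomial_remainder I (f * 'X_[w]).
have f0P a : a \in P <-> a * f0 \in I.
  rewrite fwP -[f * _](subrK f0) mulrDr; split=> h; last first.
    by apply: rpredD => //; apply: idealMr.
  rewrite -[_ * f0](addKr (a * (f * 'X_[w] - f0))); apply: rpredD => //.
  by rewrite rpredN; apply: idealMr.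
have f0n : f0 != 0.
  by apply: contraFN (idealr1 P) => /eqP f00; apply/f0P; rewrite f00 mulr0 idealr0.
have uf := mlead_supp f0n; set u := mlead f0 in uf.
have [+ uI] := f0S _ uf; rewrite (perm_mem (msuppMX _ _)) => /mapP[u1 _ uE].
have uB i : i \notin S -> (B <= u i)%N.
  by move=> iS; rewrite uE mnmDE mnmE (negbTE iS) leq_addr.
have PS : {subset P <= var_prime K S}.
  move=> g gP; have [g0 g0S g0n] := monomial_remainder (var_prime K S) g.
  have [g00|g0n0] := eqVneq g0 0; first by rewrite g00 subr0 in g0S.
  have g0P : g0 \in P.
    by rewrite -[g0](subKr g); apply: rpredB => //; apply: SP.
  (* A generator divides the leading monomial of g0 f0. It then divides x^u too: the leading
     monomial of g0 avoids S, and outside S the exponents of u are at least B. *)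
  have := @msupp_generated _ (mlead g0 + u)%MM ((f0P g0).1 g0P).
  rewrite -mleadM // mlead_supp ?mulf_neq0 // => /(_ isT).
  rewrite mleadM // => /mpolyX_generated[h hG /mnm_lepP hle].
  case/negP: uI; apply/mpolyX_generated; exists h => //; apply/mnm_lepP => i.
  have [iS|/uB] := boolP (i \in S); last exact/leq_trans/generator_le_bound.
  have := hle i; rewrite mnmDE; have [_] := g0n _ (mlead_supp g0n0).
  rewrite mpolyX_in_var_prime => /exists_inPn/(_ i iS).
  by rewrite negbK => /eqP->.
exists S; split; first by move=> a; apply/idP/idP => [/PS|/SP].
exists u; split=> // i; rewrite inE => /f0P h.
apply: (@msupp_generated _ _ h).
by rewrite mulrC (perm_mem (msuppMX _ _)) map_f.
Qed.

(* For each x_i in S some generator divides x_i u but not u, and its exponent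
   in x_i exceeds that of u; hence distinct variables need distinct generators. *)
Lemma card_associated_le S u : ('X_[u] : R) \notin I ->
  (forall i, i \in S -> ('X_[U_(i) + u] : R) \in I) -> (#|S| <= #|` G|)%N.
Proof.
move=> uI uS.
have /choice[h hP] : forall i, exists g, i \in S ->
    [/\ g \in G, (g <= U_(i) + u)%MM & (u i < g i)%N].
  move=> i; case: (boolP (i \in S)) => [iS|_]; last by exists 0%MM.
  have [g gG gle] := (mpolyX_generated _).1 (uS i iS); exists g => _; split=> //.
  rewrite ltnNge; apply: contra uI => gi.
  apply/mpolyX_generated; exists g => //; apply/mnm_lepP => j.
  have [<-//|ij] := eqVneq i j.
  by move/mnm_lepP/(_ j): gle; rewrite mnmDE mnm1E (negbTE ij).
rewrite cardE -(size_map h); apply: uniq_leq_size.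
  rewrite map_inj_in_uniq ?enum_uniq // => i j.
  rewrite !mem_enum => iS jS hij; apply/eqP; apply: contraT => ij.
  have [_ _ hi] := hP i iS; have [_ /mnm_lepP/(_ i) hj _] := hP j jS.
  move: hi; rewrite hij ltnNge; move: hj.
  by rewrite mnmDE mnm1E eq_sym (negbTE ij) => ->.
move=> _ /mapP[i iS ->]; rewrite mem_enum in iS.
by have [] := hP i iS.
Qed.

(** The hypotheses give (I : x^u) = P_S: outside S the exponents of u already reach those of every
    generator, so only a variable of S can carry x^u into I. *)
Lemma associated_var_prime S u : ('X_[u] : R) \notin I ->
  (forall i, i \in S -> ('X_[U_(i) + u] : R) \in I) ->
  (forall g i, g \in G -> i \notin S -> (g i <= u i)%N) ->
  associated_prime I (var_prime K S).
Proof.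
move=> uI uS uG; apply/associated_primeP; exists 'X_[u] => a; split.
  move=> /in_var_prime aS; apply: mem_idealr_msupp => m.
  rewrite (perm_mem (msuppMX _ _)) => /mapP[m' /aS/hitsP[i iS mi] ->].
  have [|b ->] := @mpolyX_divides K _ (U_(i) + u)%MM (u + m')%MM.
    apply/mnm_lepP => j; rewrite !mnmDE addnC leq_add2l mnm1E.
    by case: eqP => // <-; rewrite lt0n.
  by apply: idealMr; apply: uS.
move=> auI; apply/in_var_prime => m ma; apply: contraNT uI => /exists_inPn mS.
have [|g gG /mnm_lepP gle] := (mem_generated _).1 auI (u + m)%MM.
  by rewrite (perm_mem (msuppMX _ _)) map_f.
apply/mpolyX_generated; exists g => //; apply/mnm_lepP => i.
have [iS|iS] := boolP (i \in S); last exact: uG.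
have := gle i; rewrite mnmDE; have := mS i iS.
by rewrite negbK => /eqP->; rewrite addn0.
Qed.

(** In a minimal cover T each variable has a private generator, involving no other variable of T.
    This bounds the monomials x^u outside I with exponent B off T, and one of maximal degree
    satisfies (I : x^u) = P_T. *)
Lemma minimal_cover_associated S : (forall g, g \in G -> hits S g) ->
  exists2 T : {set 'I_n}, T \subset S & associated_prime I (var_prime K T).
Proof.
pose covers T := [forall g : G, hits T (val g)].
have coversP T : reflect (forall g, g \in G -> hits T g) (covers T).
  apply: (iffP forallP) => [h g gG|h g]; first exact: (h [` gG]%fset).
  exact/h/valP.
move=> /coversP/minset_exists[T /minsetP[/coversP cT minT] TS].
exists T => //.
have priv i : i \in T -> exists2 g, g \in G &
    forall j, j \in T -> j != i -> g j = 0%N.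
  move=> iT; apply: contrapT => /forall2NP ng.
  have /minT : covers (T :\ i).
    apply/coversP => g gG; case: (ng g) => // /existsNP[j /not_implyP[jT]].
    move=> /not_implyP[ji /eqP gj]; apply/hitsP; exists j => //.
    by rewrite !inE ji.
  by move=> /(_ (subsetDl _ _))/setP/(_ i); rewrite !inE eqxx iT.
pose good u := ('X_[u] : R) \notin I /\ forall i, i \notin T -> u i = B.
pose u0 : 'X_{1..n} := [multinom if i \in T then 0%N else B | i < n].
have gu0 : good u0.
  split; last by move=> i /negbTE iT; rewrite mnmE iT.
  apply/negP => /mpolyX_generated[g gG /mnm_lepP gle].
  have /hitsP[i iT] := cT g gG; have := gle i; rewrite mnmE iT leqn0.
  by move=> ->.
have goodB u : good u -> (mdeg u <= n * B)%N.
  move=> [uI uT]; rewrite mdegE -[n in (n * _)%N]card_ord -sum_nat_const.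
  apply: leq_sum => i _; have [iT|/uT->//] := boolP (i \in T).
  have [g gG gT] := priv i iT; rewrite leqNgt; apply: contra uI => ui.
  apply/mpolyX_generated; exists g => //; apply/mnm_lepP => j.
  have [jT|/uT->] := boolP (j \in T); last exact: generator_le_bound.
  have [->|/(gT j jT)->//] := eqVneq j i.
  exact: leq_trans (generator_le_bound i gG) (ltnW ui).
have exg : exists d, `[< exists2 u, good u & mdeg u = d >].
  by exists (mdeg u0); apply/asboolP; exists u0.
have bdg d : `[< exists2 u, good u & mdeg u = d >] -> (d <= n * B)%N.
  by move=> /asboolP[u /goodB h <-].
case: (ex_maxnP exg bdg) => d /asboolP[u gu ud] maxu.
have [uI uT] := gu; apply: (associated_var_prime uI) => [i iT|g i gG /uT->].
  apply/negPn/negP => nI; have /maxu : `[< exists2 v, good v & mdeg v = d.+1 >].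
    apply/asboolP; exists (U_(i) + u)%MM; last by rewrite mdegD mdeg1 ud.
    split=> // j jT; rewrite mnmDE uT // mnm1E; case: eqP => // ij.
    by rewrite -ij iT in jT.
  by rewrite ltnn.
exact: generator_le_bound.
Qed.

Lemma complete_intersection_unmixed : height I #|` G| -> unmixed I.
Proof.
move=> [_ Ih]; exists #|` G| => P aP.
have [S [PS [u [uI uS]]]] := associated_prime_monomial aP.
have IP : {subset I <= P}.
  move=> a aI; have [f fP] := (associated_primeP _ _).1 aP.
  by apply/fP; rewrite mulrC idealMr.
have hP : prime_height P #|S|.
  by apply: eq_prime_height (prime_height_var_prime K S) => x; rewrite PS.
have Sq : #|S| = #|` G|.
  by apply/eqP; rewrite eqn_leq (card_associated_le uI uS) (hP.2 _ (Ih P IP)).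
by rewrite -Sq.
Qed.

Lemma dominant_associated : (forall m, m \in G -> exists k, forall m', m' \in G ->
    m' != m -> (m' k < m k)%N) ->
  exists2 S : {set 'I_n}, #|S| = #|` G| & associated_prime I (var_prime K S).
Proof.
move=> dom.
(* If G = {m}, the condition on k is vacuous and k is replaced by a variable dividing m; otherwise
   the strict inequality makes m k positive. *)
have dom' m : m \in G -> exists k : 'I_n, (0 < m k)%N /\
    forall m', m' \in G -> m' != m -> (m' k < m k)%N.
  move=> mG; have [k kP] := dom m mG.
  case: (pselect (exists2 m', m' \in G & m' != m)) => [[m' m'G m'm]|/forall2NP nm].
    by exists k; split=> //; apply: leq_ltn_trans (kP _ m'G m'm).
  have [i mi] : exists i, m i != 0%N.
    apply: contrapT => /forallNP mi; have := generator_neq0 mG.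
    by move/eqP; apply; apply/mnmP => i; rewrite mnm0E; apply/eqP/negPn/negP/mi.
  exists i; split=> [|m' m'G]; first by rewrite lt0n.
  by case: (nm m').
pose M i := \max_(g <- G) g i.
have MG g i : g \in G -> (g i <= M i)%N.
  by move=> gG; rewrite /M; apply: leq_bigmax_seq gG isT.
have [G0|[m0 m0G]] : G = fset0 \/ exists m, m \in G.
  by case: (eqVneq G fset0) => [|/fset0Pn]; [left|right].
  exists set0; first by rewrite G0 cards0 cardfs0.
  apply: (@associated_var_prime set0 0%MM) => [|i|g i]; last by rewrite G0 inE.
    by apply/negP => /mpolyX_generated[g]; rewrite G0 inE.
  by rewrite inE.
have [k0 _] := dom m0 m0G.
have /choice[k kP] : forall m, exists k : 'I_n, m \in G -> (0 < m k)%N /\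
    forall m', m' \in G -> m' != m -> (m' k < m k)%N.
  by move=> m; case: (boolP (m \in G)) => [/dom'[k kP]|_]; [exists k | exists k0].
have kinj : {in G &, injective k}.
  move=> m m' mG m'G kE; apply/eqP; apply: contraT => mm'.
  have [_ /(_ m mG mm') h'] := kP m' m'G.
  have [_ /(_ m' m'G)] := kP m mG; rewrite eq_sym mm' kE => /(_ isT).
  by rewrite ltnNge ltnW.
pose S := [set i in map k G].
have SP i : reflect (exists2 m, m \in G & i = k m) (i \in S).
  by rewrite inE; apply: mapP.
have Mk m : m \in G -> M (k m) = m (k m).
  move=> mG; apply/eqP; rewrite eqn_leq MG // andbT.
  apply/bigmax_leqP_seq => m' m'G _; have [->//|m'm] := eqVneq m' m.
  by have [_ /(_ m' m'G m'm)/ltnW] := kP m mG.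
exists S.
  by rewrite cardsE (card_uniqP _) ?size_map // map_inj_in_uniq ?fset_uniq.
(* x^u is the lcm of the generators divided once by each k m; the predecessor is genuine because M
   (k m) = m (k m) > 0. No generator divides x^u, and restoring k m makes m divide it. *)
pose u : 'X_{1..n} := [multinom if i \in S then (M i).-1 else M i | i < n].
apply: (@associated_var_prime S u) => [|i /SP[m mG ->]|g i gG iS]; last first.
- by rewrite mnmE (negbTE iS) MG.
- apply/mpolyX_generated; exists m => //; apply/mnm_lepP => j.
  rewrite mnmDE mnm1E mnmE; have [<-|kj] := eqVneq (k m) j.
    by rewrite ifT; [rewrite Mk //; case: (m (k m)) | apply/SP; exists m].
  case: ifP => [/SP[m' m'G jE]|_]; last exact: MG.
  rewrite jE Mk //; have [m'0 /(_ m mG)] := kP m' m'G.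
  have mm' : m != m' by apply: contra_neq kj => ->.
  by move=> /(_ mm'); case: (m' _).
- apply/negP => /mpolyX_generated[g gG /mnm_lepP/(_ (k g))].
  rewrite mnmE ifT; last by apply/SP; exists g.
  by rewrite Mk //; have [] := kP g gG; case: (g (k g)) => // d; rewrite ltnn.
Qed.

Lemma unmixed_complete_intersection : (forall m, m \in G -> exists k,
    forall m', m' \in G -> m' != m -> (m' k < m k)%N) ->
  unmixed I -> height I #|` G|.
Proof.
move=> /dominant_associated[S SG aS] [h hI].
have Sh : #|S| = h.
  exact: prime_height_uniq (prime_height_var_prime K S) (hI _ aS).
rewrite -SG; split.
  exists (var_prime K S); last exact: prime_height_var_prime.
  move=> a aI; have [f fP] := (associated_primeP _ _).1 aS.
  by apply/fP; rewrite mulrC idealMr.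
move=> P /prime_hits/minimal_cover_associated[T TP aT].
have [hT _] := hI _ aT; apply: height_ge_sub (_ : height_ge (var_prime K T) _).
  apply: var_prime_sub => i iT.
  by have := subsetP TP i iT; rewrite inE.
by rewrite Sh.
Qed.

End MonomialAssociatedPrimes.

(** * Leading monomials *)

Section NoetherianPolynomials.
Variables (K : fieldType) (n : nat).
Local Notation R := {mpoly K[n]}.
Implicit Types (m : 'X_{1..n}) (f h : R).

(** Take a position where a tail attains its minimum, then repeat beyond it. *)
Lemma nondecreasing_subseq (u : nat -> nat) : exists g : nat -> nat,
  forall k, (g k < g k.+1)%N /\ (u (g k) <= u (g k.+1))%N.
Proof.
have /choice[a aP] : forall N, exists a, (N <= a)%N /\
    forall b, (N <= b)%N -> (u a <= u b)%N.
  move=> N; pose Q v := `[< exists2 b, (N <= b)%N & u b = v >].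
  have exQ : exists v, Q v by exists (u N); apply/asboolP; exists N.
  case: (ex_minnP exQ) => v /asboolP[b Nb <-] minv; exists b; split=> // c Nc.
  by apply: minv; apply/asboolP; exists c.
pose s := fix s k := if k is k'.+1 then (a (s k')).+1 else 0%N.
exists (fun k => a (s k)) => k; have [ka mina] := aP (s k).
have [kas _] := aP (s k.+1); split=> //.
by apply: mina; apply: leq_trans kas; rewrite /= leqW.
Qed.

(** Subsequences are refined one variable at a time until every exponent is nondecreasing. *)
Lemma dickson (f : nat -> 'X_{1..n}) : exists i j, (i < j)%N /\ (f i <= f j)%MM.
Proof.
suff [g gP] : exists g : nat -> nat, forall k, (g k < g k.+1)%N /\
    forall i, i \in enum 'I_n -> (f (g k) i <= f (g k.+1) i)%N.
  exists (g 0%N), (g 1%N); have [g01 fg] := gP 0%N; split=> //.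
  by apply/mnm_lepP => i; apply: fg; rewrite mem_enum.
elim: (enum 'I_n) => [|i l [g gP]]; first by exists id.
have [g' g'P] := nondecreasing_subseq (fun k => f (g k) i).
exists (g \o g') => k /=; have [kk ui] := g'P k; split.
  by apply: (homo_ltn ltn_trans) kk => j; have [] := gP j.
move=> j; rewrite inE => /predU1P[->//|jl].
apply: (homo_leq (f := fun k => f (g k) j) (r := leq) (@leqnn) leq_trans) (ltnW kk).
by move=> k'; have [_] := gP k'; apply.
Qed.

Lemma mlead_cancel f h : f != 0 -> h != 0 -> mlead f = mlead h ->
  exists c, f - c *: h = 0 \/ (mlead (f - c *: h) < mlead f)%O.
Proof.
move=> f0 h0 fh; exists (f@_(mlead f) / h@_(mlead f)); set c := _ / _.
have [->|r0] := eqVneq (f - c *: h) 0; [by left | right].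
rewrite lt_neqAle; apply/andP; split.
  apply: contraTneq (mlead_supp r0) => ->.
  rewrite mcoeff_msupp negbK mcoeffB mcoeffZ /c divfK ?subrr //.
  by rewrite fh mleadc_eq0.
apply: le_trans (mleadB_le _ _) _; rewrite leUx lexx /= fh.
exact: mleadZ_le.
Qed.

(** By Dickson's lemma the sets of leading monomials of the J k stabilise. From then on, elements of
    later ideals are reduced to 0 by elements of J k, by induction on the leading monomial. *)
Theorem acc_mpoly : ascending_chain_condition R.
Proof.
move=> J iJ Jinc.
have Jle k k' f : (k <= k')%N -> J k f -> J k' f.
  move=> kk'; rewrite -(subnK kk'); elim: (k' - k)%N => // d IH /IH.
  exact: Jinc.
pose L k m := exists f, [/\ J k f, f != 0 & mlead f = m].
have [k kL] : exists k, forall k' m, L k' m -> L k m.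
  apply: contrapT => /forallNP nL.
  have /choice[nx nxP] : forall k, exists km : nat * 'X_{1..n},
      L km.1 km.2 /\ ~ L k km.2.
    move=> k; apply: contrapT => /forallNP nk; apply: (nL k) => k' m Lk'.
    by apply: contrapT => nLk; apply: (nk (k', m)).
  (* Stage ks (i+1) contains the leading monomial found missing at stage ks i. If it divided the one
     found missing at a later stage ks j, the latter would be present there. *)
  pose ks := fix ks i := if i is i'.+1 then maxn (ks i') (nx (ks i')).1 else 0%N.
  have Lle k k' m : (k <= k')%N -> L k m -> L k' m.
    by move=> kk' [f [Jf f0 fm]]; exists f; split=> //; apply: Jle Jf.
  have [i [j [ij eij]]] := dickson (fun i => (nx (ks i)).2).
  have [_] := nxP (ks j); apply.
  have [Li _] := nxP (ks i).
  have [f [Jf f0 fm]] : L (ks j) (nx (ks i)).2.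
    apply: Lle Li; apply: leq_trans (_ : ks i.+1 <= _)%N; first exact: leq_maxr.
    by apply: (homo_leq (r := leq) (@leqnn) leq_trans) ij => l; apply: leq_maxl.
  have [b0 bE] : exists b : 'X_{1..n}, (nx (ks j)).2 = (b + mlead f)%MM.
    by exists ((nx (ks j)).2 - mlead f)%MM; rewrite fm submK.
  have X0 : 'X_[b0] != 0 :> R by rewrite -msupp_eq0 msuppX.
  exists ('X_[b0] * f); split; first exact: is_idealM.
    by rewrite mulf_neq0.
  by rewrite mleadM // mleadXm bE.
exists k => k' f; elim/mleadrect: f k' => f IH k' Jf.
have [->|f0] := eqVneq f 0; first exact: is_ideal0.
have [h [Jh h0 hm]] : L k (mlead f) by apply: (kL k'); exists f.
have [c fc] := mlead_cancel f0 h0 (esym hm).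
have Jch : J k (c *: h) by rewrite -mul_mpolyC; apply: is_idealM.
rewrite -(subrK (c *: h) f); apply: is_idealD => //.
case: fc => [->|lt]; first exact: is_ideal0.
apply: (IH _ lt (maxn k k')); apply: is_idealB => //.
  by apply: Jle Jf; apply: leq_maxr.
by apply: Jle Jch; apply: leq_maxl.
Qed.

End NoetherianPolynomials.

(** * Polynomials led by powers of distinct variables *)

Section PureLeadingPowers.
Variables (K : fieldType) (n : nat) (h : 'I_n -> {mpoly K[n]}) (d : 'I_n -> nat).
Local Notation R := {mpoly K[n]}.
Hypothesis h_neq0 : forall i, h i != 0.
Hypothesis mlead_h : forall i, mlead (h i) = (U_(i) *+ d i)%MM.
Implicit Types (vs : seq 'I_n) (m : 'X_{1..n}).

Let gen vs : R -> Prop := ideal_gen (fun g => g \in map h vs).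
Let reduced vs m := all (fun i => m i < d i)%N vs.

(** Division: a multiple of h i cancels a leading monomial divisible by that of h i, and the
    monomial order is well-founded. *)
Lemma gen_reduce vs b :
  gen vs b \/ exists r, [/\ gen vs (b - r), r != 0 & reduced vs (mlead r)].
Proof.
have iG : is_ideal (gen vs) by apply: is_ideal_gen.
elim/mleadrect: b => b IH.
have [->|b0] := eqVneq b 0; first by left; apply: is_ideal0.
have [rb|/allPn[i ivs]] := boolP (reduced vs (mlead b)).
  by right; exists b; rewrite subrr; split=> //; apply: is_ideal0.
rewrite -leqNgt => db; pose q : R := 'X_[mlead b - U_(i) *+ d i] * h i.
have X0 m : 'X_[m] != 0 :> R by rewrite -msupp_eq0 msuppX.
have q0 : q != 0 by rewrite mulf_neq0.
have bq : mlead b = mlead q.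
  rewrite mleadM // mleadXm mlead_h submK //; apply/mnm_lepP => j.
  by rewrite mulmnE mnm1E; case: eqP => [<-|_]; rewrite ?mul1n ?mul0n.
have [c bc] := mlead_cancel b0 q0 bq.
have Gq : gen vs (c *: q).
  rewrite -mul_mpolyC; apply: is_idealM => //; apply: is_idealM => //.
  by apply: mem_ideal_gen; apply: map_f.
case: bc => [/subr0_eq->|lt]; first by left.
case: (IH _ lt) => [Gb|[r [Gr r0 rr]]].
  by left; rewrite -(subrK (c *: q) b); apply: is_idealD.
right; exists r; split=> //.
have -> : b - r = (b - c *: q - r) + c *: q by rewrite addrAC subrK.
exact: is_idealD.
Qed.

Lemma reduced_mleadM vs i r : i \notin vs -> r != 0 ->
  reduced vs (mlead r) -> reduced vs (mlead (r * h i)).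
Proof.
move=> ivs r0 /allP rr; apply/allP => j jvs.
rewrite mleadM // mlead_h mnmDE mulmnE mnm1E.
by case: eqP => [E|_]; [rewrite E jvs in ivs | rewrite mul0n addn0 rr].
Qed.

(* Buchberger's criterion for pairwise coprime leading monomials. *)
Lemma gen_mlead vs f : uniq vs -> gen vs f -> f != 0 -> ~~ reduced vs (mlead f).
Proof.
elim/last_ind: vs f => [|vs i IH] f.
  move=> _ [s [c [sS ->]]] /negP[]; case: s sS => [|x s] sS.
    by rewrite big_ord0.
  by have := sS x (mem_head _ _).
rewrite rcons_uniq => /andP[ivs uvs].
rewrite /gen map_rcons => /ideal_gen_rcons[g Gg [c ->]] f0.
rewrite /reduced all_rcons negb_and; apply/orP.
have iG : is_ideal (gen vs) by apply: is_ideal_gen.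
case: (gen_reduce vs c) => [Gc|[r [Gcr r0 rr]]].
  right; apply: IH => //; apply: is_idealD => //; exact: is_idealMr.
pose g' := g + (c - r) * h i.
have Gg' : gen vs g' by apply: is_idealD => //; exact: is_idealMr.
have E : g + c * h i = g' + r * h i by rewrite /g' mulrBl -addrA subrK.
have red := reduced_mleadM ivs r0 rr.
have dr : (d i <= mlead (r * h i) i)%N.
  by rewrite mleadM // mlead_h mnmDE mulmnE mnm1E eqxx mul1n leq_addl.
rewrite E in f0 *; have [g0|g0] := eqVneq g' 0.
  by left; rewrite g0 add0r -leqNgt.
have nred := IH _ uvs Gg' g0.
(* Replacing c by its remainder r makes the second leading monomial reduced for vs, which the first
   is not; so the two cannot cancel. *)
have neq : mlead g' != mlead (r * h i) by apply: contraNneq nred => ->.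
rewrite mleadD //; case: (leP (mlead g') (mlead (r * h i))) => _.
  by left; rewrite -leqNgt.
by right.
Qed.

(** A nonzero remainder r of b would put r h_i into the ideal with a leading monomial reduced for
    [vs], against [gen_mlead]. *)
Lemma gen_regular vs i b : uniq (rcons vs i) ->
  gen vs (h i * b) -> gen vs b.
Proof.
rewrite rcons_uniq => /andP[ivs uvs] Ghb.
have iG : is_ideal (gen vs) by apply: is_ideal_gen.
case: (gen_reduce vs b) => // -[r [Gbr r0 rr]].
have : gen vs (r * h i).
  have -> : r * h i = h i * b - h i * (b - r) by ring.
  by apply: is_idealB => //; apply: is_idealM.
move/(gen_mlead uvs)/(_ (mulf_neq0 r0 (h_neq0 i))).
by rewrite reduced_mleadM.
Qed.

End PureLeadingPowers.

(** * Zariski's lemma *)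

Section ZariskiLemma.

Lemma integral_exp (D L : comNzRingType) (psi : {rmorphism D -> L}) x k :
  integralOver psi x -> integralOver psi (x ^+ k).
Proof.
move=> ix; elim: k => [|k IH]; first exact: integral1.
by rewrite exprS; apply: integral_mul.
Qed.

Section Integrality.
Variables (D : comNzRingType) (L : fieldType) (psi : {rmorphism D -> L}).
Local Notation integral := (integralOver psi).

(** For p of degree m, e z is a root of the monic polynomial with coefficients e^(m - i) p_i. *)
Lemma integral_scale (p : {poly L}) e z : p \is monic -> root p z ->
  (forall i, (i < (size p).-1)%N -> integral (e ^+ ((size p).-1 - i) * p`_i)) ->
  integral (e * z).
Proof.
move=> pm /rootP pz ip; set m := (size p).-1 in ip.
have sp : size p = m.+1 by rewrite prednK // size_poly_gt0 monic_neq0.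
pose q := \poly_(i < m.+1) (e ^+ (m - i) * p`_i).
have pmE : p`_m = 1 by exact/eqP/pm.
have sq : size q = m.+1.
  by apply: size_poly_eq; rewrite subnn expr0 mul1r pmE oner_neq0.
apply: (@integral_root_monic _ _ _ _ q).
- by rewrite monicE /lead_coef sq coef_poly ltnSn subnn expr0 mul1r pmE.
- apply/rootP; rewrite -(mulr0 (e ^+ m)) -pz horner_poly (horner_coef p) sp.
  rewrite mulr_sumr; apply: eq_bigr => i _.
  have im : (i <= m)%N by rewrite -ltnS.
  have -> : e ^+ m = e ^+ (m - i) * e ^+ i by rewrite -exprD subnK.
  rewrite exprMn; ring.
- apply/integral_poly => i; rewrite coef_poly ltnS.
  case: ifP => [|_]; last exact: integral0.
  rewrite leq_eqVlt => /predU1P[->|im]; last exact: ip.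
  by rewrite subnn expr0 mul1r pmE; apply: integral1.
Qed.

Lemma integral_lead_coef (p : {poly L}) z : p != 0 -> root p z ->
  (forall i, integral p`_i) -> integral (lead_coef p * z).
Proof.
move=> p0 pz ip; have c0 : lead_coef p != 0 by rewrite lead_coef_eq0.
have sE : size ((lead_coef p)^-1 *: p) = size p by rewrite size_scale ?invr_eq0.
apply: (@integral_scale ((lead_coef p)^-1 *: p)).
- by rewrite monicE lead_coefZ mulVf.
- by rewrite rootZ // invr_eq0.
- move=> i; rewrite sE => im; rewrite coefZ mulrA -[(_ - _)%N]prednK ?subn_gt0 //.
  rewrite exprSr mulfK //; apply: integral_mul; last exact: ip.
  exact/integral_exp/ip.
Qed.

(** Multiply an integral equation of degree m for x / y by y^m. *)
Lemma integral_fraction_dvd (x y : D) : psi y != 0 -> integral (psi x / psi y) ->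
  exists k r, psi (x ^+ k) = psi (y * r).
Proof.
move=> y0 [p pm /rootP pz].
have [m sp] : exists m, size p = m.+1.
  by exists (size p).-1; rewrite prednK // size_poly_gt0 monic_neq0.
have pmE : p`_m = 1 by have /eqP := pm; rewrite /lead_coef sp.
exists m, (- \sum_(i < m) p`_i * x ^+ i * y ^+ (m - i.+1)).
have sp' : (size (map_poly psi p) <= m.+1)%N by rewrite -sp size_poly.
move: pz; rewrite (horner_coef_wide _ sp') big_ord_recr /=.
rewrite coef_map /= pmE rmorph1 mul1r => E.
set z := psi x / psi y in E; set s1 := \sum_(i < m) _ in E.
have {}E : z ^+ m = - s1 by apply/eqP; rewrite -addr_eq0 addrC E.
have xE : psi x = z * psi y by rewrite divfK.
clearbody z.
rewrite rmorphM rmorphN rmorph_sum mulrN mulr_sumr rmorphXn /= xE exprMn E.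
rewrite mulNr mulr_suml; congr (- _); apply: eq_bigr => i _.
rewrite coef_map /= !rmorphM !rmorphXn /= xE exprMn.
have -> : psi y ^+ m = psi y * psi y ^+ i * psi y ^+ (m - i.+1).
  by rewrite -exprS -exprD subnKC.
ring.
Qed.

End Integrality.

(** The D-subalgebra generated by [s], as an intersection of subrings; this form passes easily from
    D to D[X]. *)
Definition generated_by (D L : comNzRingType) (psi : D -> L) (s : seq L) (y : L) :=
  forall T : L -> Prop, (forall x z, T x -> T z -> T (x - z) /\ T (x * z)) ->
  (forall d, T (psi d)) -> (forall a, a \in s -> T a) -> T y.

Definition eval_at (D L : comNzRingType) (psi : {rmorphism D -> L}) (a : L) :
    {rmorphism {poly D} -> L} :=
  horner_morph (fun x => mulrC a (psi x) : GRing.comm a (psi x)).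

Lemma eval_atE (D L : comNzRingType) (psi : {rmorphism D -> L}) a p :
  eval_at psi a p = (map_poly psi p).[a].
Proof. by []. Qed.

Section OneGenerator.
Variables (D : comNzRingType) (L : fieldType) (psi : {rmorphism D -> L}) (a : L).
Local Notation ev := (eval_at psi a).

(* If a were transcendental, 1 + X f would have no inverse in D[a][1/f]. *)
Lemma generator_algebraic (f : {poly D}) : ev f != 0 ->
  (forall y, exists N, integralOver ev (ev f ^+ N * y)) ->
  exists q : {poly D}, map_poly psi q != 0 /\ ev q = 0.
Proof.
move=> f0 int_f; pose p := 1 + 'X * f.
have pf0 : map_poly psi f != 0.
  by apply: contraNneq f0 => E; rewrite eval_atE E horner0.
have sp : (1 < size (map_poly psi p))%N.
  have sXf : size ('X * map_poly psi f) = (size (map_poly psi f)).+1.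
    by rewrite mulrC size_mulX.
  rewrite rmorphD rmorph1 rmorphM /= map_polyX addrC size_polyDl sXf.
    by rewrite ltnS size_poly_gt0.
  by rewrite size_poly1 ltnS size_poly_gt0.
have [p0|p0] := eqVneq (ev p) 0.
  by exists p; split=> //; rewrite -size_poly_gt0 ltnW.
have [N] := int_f (ev p)^-1; rewrite -rmorphXn => /(integral_fraction_dvd p0).
move=> [k [r]]; rewrite -exprM; move: (N * k)%N => {N k} M E.
(* Modulo p the product X f is -1, so p divides X^M f^M - (-1)^M. After evaluation at a, p also
   divides f^M, so p(a) has an inverse polynomial in a; q records this relation. *)
have [r' r'E] : exists r', (p - 1) ^+ M = p * r' + (-1) ^+ M.
  elim: M {E} => [|M [r' IH]]; first by exists 0; rewrite mulr0 add0r !expr0.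
  exists ((p - 1) * r' + (-1) ^+ M); rewrite exprS IH [(-1) ^+ _.+1]exprS; ring.
have pX : (p - 1) ^+ M = 'X^M * f ^+ M by rewrite /p addrC addKr exprMn.
pose q := 1 - p * ((-1) ^+ M * ('X^M * r - r')).
exists q; split.
  (* If q vanished over L, p would be a unit of L[X], but its degree there is positive. *)
  apply: contraTneq sp => /eqP; rewrite rmorphB rmorph1 rmorphM subr_eq0 => /eqP E1.
  rewrite -leqNgt; have := poly_unitE (map_poly psi p).
  have -> : map_poly psi p \is a GRing.unit.
    by apply/unitrPr; exists (map_poly psi ((-1) ^+ M * ('X^M * r - r'))); rewrite -E1.
  by move/esym/andP => [/eqP->].
have E2 : ev ('X^M * (p * r)) = ev (p * r' + (-1) ^+ M).
  by rewrite -r'E pX !rmorphM E -rmorphM.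
have qE : q = (-1) ^+ M * (p * r' + (-1) ^+ M - 'X^M * (p * r)).
  have s1 : (-1) ^+ M * (-1) ^+ M = 1 :> {poly D}.
    by rewrite -exprMn mulrNN mulr1 expr1n.
  have ident (e P Y r1 r2 : {poly D}) : e * e = 1 ->
      1 - P * (e * (Y * r1 - r2)) = e * (P * r2 + e - Y * (P * r1)).
    by move=> <-; ring.
  exact: ident.
by rewrite qE rmorphM rmorphB E2 subrr mulr0.
Qed.

Local Notation integral := (integralOver psi).

Lemma integral_clear_denominators c : integral (psi c * a) ->
  forall g : {poly D}, exists k, forall l, (k <= l)%N -> integral (psi c ^+ l * ev g).
Proof.
move=> ica g; exists (size g) => l gl.
have gl' : (size (map_poly psi g) <= l)%N by apply: leq_trans gl; apply: size_poly.
rewrite eval_atE (horner_coef_wide _ gl') mulr_sumr.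
apply: (big_ind integral); [exact: integral0 | exact: integral_add |] => i _.
rewrite coef_map -{1}(subnK (ltnW (ltn_ord i))) exprD.
have -> : psi c ^+ (l - i) * psi c ^+ i * (psi g`_i * a ^+ i) =
  psi (c ^+ (l - i) * g`_i) * (psi c * a) ^+ i.
  by rewrite rmorphM rmorphXn exprMn; ring.
by apply: integral_mul; [exact: integral_id | exact: integral_exp].
Qed.

(** A power of c clears the denominators of all coefficients of a monic equation for w at once;
    [integral_scale] then applies. *)
Lemma integral_transfer c : integral (psi c * a) ->
  forall w, integralOver ev w -> exists k, integral (psi c ^+ k * w).
Proof.
move=> ica w [P Pm Pw].
have [k kP] : exists k, forall i, integral (psi c ^+ k * ev P`_i).
  have [k kP] : exists k, forall i, (i < size P)%N -> forall l, (k <= l)%N ->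
      integral (psi c ^+ l * ev P`_i).
    elim: (size P) => [|s [k kP]]; first by exists 0%N.
    have [k' k'P] := integral_clear_denominators ica P`_s.
    exists (maxn k k') => i; rewrite ltnS leq_eqVlt => /predU1P[->|lis] l.
      by rewrite geq_max => /andP[_]; apply: k'P.
    by rewrite geq_max => /andP[kl _]; apply: kP.
  exists k => i; case: (ltnP i (size P)) => [iP|Pi]; first exact: kP.
  by rewrite nth_default // rmorph0 mulr0; apply: integral0.
exists k; apply: (@integral_scale _ _ psi (map_poly ev P)) => //.
  by rewrite monic_map.
move=> i im; rewrite -[(_ - _)%N]prednK ?subn_gt0 // exprSr -mulrA coef_map.
apply: integral_mul; last exact: kP.
by do 2!apply: integral_exp; apply: integral_id.
Qed.

Lemma algebraic_scaled_integral (q : {poly D}) z :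
  map_poly psi q != 0 -> (map_poly psi q).[z] = 0 ->
  exists c, psi c != 0 /\ integral (psi c * z).
Proof.
move=> q0 qz; exists q`_(size (map_poly psi q)).-1.
rewrite -coef_map -/(lead_coef _) lead_coef_eq0; split=> //.
apply: integral_lead_coef => //; first exact/rootP.
by move=> i; rewrite coef_map; apply: integral_id.
Qed.

(** 1 / G is a root of the reversed integral equation of G, which is nonzero since its constant
    coefficient is 1. *)
Lemma integral_inverse G : G != 0 -> integral G ->
  exists c, psi c != 0 /\ integral (psi c / G).
Proof.
move=> G0 [p pm /rootP pG]; have [m sp] : exists m, size p = m.+1.
  by exists (size p).-1; rewrite prednK // size_poly_gt0 monic_neq0.
have pmE : p`_m = 1 by have /eqP := pm; rewrite /lead_coef sp.
have sp' : (size (map_poly psi p) <= m.+1)%N by rewrite -sp size_poly.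
pose q := \poly_(i < m.+1) p`_(m - i).
apply: (@algebraic_scaled_integral q).
  apply: contraTneq (oner_neq0 L) => /(congr1 (fun r : {poly L} => r`_0)).
  by rewrite coef_map coef_poly /= subn0 pmE rmorph1 coef0 => ->; rewrite eqxx.
have sq : (size (map_poly psi q) <= m.+1)%N.
  by apply: leq_trans (size_poly _ _) (size_poly _ _).
rewrite (horner_coef_wide _ sq).
apply: (mulfI (expf_neq0 m G0)); rewrite mulr0 -[RHS]pG (horner_coef_wide _ sp').
rewrite mulr_sumr (reindex_inj rev_ord_inj); apply: eq_bigr => i _ /=.
have im : (i <= m)%N by rewrite -ltnS.
rewrite !coef_map coef_poly subSS ltnS leq_subr subKn // exprVn mulrCA; congr (_ * _).
have -> : G ^+ m = G ^+ i * G ^+ (m - i) by rewrite -exprD subnKC.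
by rewrite mulfK ?expf_neq0.
Qed.

End OneGenerator.

(** Induction on the generators gives f over D[a]. As a is algebraic, some c makes c a integral, and
    then c^k f(a) is integral for some k. Some c1 makes c1 / (c^k f(a)) integral, so powers of c c1
    can replace those of f(a). *)
Theorem zariski_integral (L : fieldType) (s : seq L) (D : comNzRingType)
    (psi : {rmorphism D -> L}) : (forall y, generated_by psi s y) ->
  exists f, psi f != 0 /\ forall y, exists N, integralOver psi (psi f ^+ N * y).
Proof.
elim: s D psi => [|a s IH] D psi gen.
  exists 1; rewrite rmorph1 oner_neq0; split=> // y; exists 0%N.
  rewrite expr0 mul1r; apply: (gen y (integralOver psi)) => //.
    by move=> x z ix iz; split; [apply: integral_sub | apply: integral_mul].
  exact: integral_id.
have [|f [f0 int_f]] := IH _ (eval_at psi a).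
  move=> y T Tsub Tpsi Ts; apply: gen => // [d|b].
    by have := Tpsi d%:P; rewrite eval_atE map_polyC hornerC.
  rewrite inE => /predU1P[->|/Ts//].
  by have := Tpsi 'X; rewrite eval_atE map_polyX hornerX.
have [q [q0 qa]] := generator_algebraic f0 int_f.
have [c [c0 ica]] := algebraic_scaled_integral q0 qa.
have [k /(_ k (leqnn k)) iG] := integral_clear_denominators ica f.
have [|c1 [c10 ic1]] := integral_inverse _ iG.
  by rewrite mulf_neq0 ?expf_neq0.
exists (c * c1); rewrite rmorphM mulf_neq0 //; split=> // y.
have [N iN] := int_f y; have [M iM] := integral_transfer ica iN.
exists (M + N)%N.
have -> : (psi c * psi c1) ^+ (M + N) * y =
  psi (c1 ^+ M * c ^+ N) *
  ((psi c ^+ k * (psi c1 / (psi c ^+ k * eval_at psi a f))) ^+ N *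
    (psi c ^+ M * (eval_at psi a f ^+ N * y))).
  have -> : psi c ^+ k * (psi c1 / (psi c ^+ k * eval_at psi a f)) =
      psi c1 / eval_at psi a f.
    by rewrite invfM mulrCA mulVKf ?expf_neq0.
  rewrite !rmorphM !rmorphXn !exprMn !exprD exprVn.
  by field; rewrite expf_neq0.
apply: integral_mul; first exact: integral_id.
apply: integral_mul => //; apply: integral_exp; apply: integral_mul => //.
by apply: integral_exp; apply: integral_id.
Qed.

Corollary zariski (F L : fieldType) (psi : {rmorphism F -> L}) (s : seq L) :
  (forall y, generated_by psi s y) -> integralRange psi.
Proof.
move=> /zariski_integral[f [f0 int_f]] y; have [N iN] := int_f y.
have -> : y = psi (f ^- N) * (psi f ^+ N * y).
  by rewrite fmorphV rmorphXn mulKf ?expf_neq0.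
by apply: integral_mul => //; apply: integral_id.
Qed.

End ZariskiLemma.

(** * Localization *)

Section LocalizationMap.
Variables (A : comNzRingType) (P : prime_idealr A).

Definition loc_map (a : A) : localization P := locfrac a (notin_prime1 P).

Lemma loc_map_zmod_morphism : zmod_morphism loc_map.
Proof.
move=> a b; rewrite /loc_map.
have -> : locfrac a (notin_prime1 P) - locfrac b (notin_prime1 P) =
    locadd (locfrac a (notin_prime1 P)) (locopp (locfrac b (notin_prime1 P))) by [].
by rewrite locoppE locaddE; apply: eq_locfrac; ring.
Qed.

Lemma loc_map_monoid_morphism : monoid_morphism loc_map.
Proof.
split=> // a b; rewrite /loc_map.
have -> : locfrac a (notin_prime1 P) * locfrac b (notin_prime1 P) =
    locmul (locfrac a (notin_prime1 P)) (locfrac b (notin_prime1 P)) by [].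
by rewrite locmulE; apply: eq_locfrac; ring.
Qed.

HB.instance Definition _ := GRing.isZmodMorphism.Build A (localization P) loc_map
  loc_map_zmod_morphism.
HB.instance Definition _ := GRing.isMonoidMorphism.Build A (localization P) loc_map
  loc_map_monoid_morphism.

Lemma locmul_map a s (sP : s \notin P) : locfrac a sP * loc_map s = loc_map a.
Proof.
have -> : locfrac a sP * loc_map s = locmul (locfrac a sP) (loc_map s) by [].
by rewrite locmulE; apply: eq_locfrac; ring.
Qed.

Lemma loc_map_eq0 a : loc_map a = 0 <-> exists2 u, u \notin P & u * a = 0.
Proof.
rewrite -(rmorph0 loc_map) locfracE.
by split=> -[u uP h]; exists u => //; move: h; rewrite !mulr1 subr0.
Qed.

End LocalizationMap.

Section LocalizedQuotients.
Variables (R B : comNzRingType) (I : idealr R) (m : prime_idealr R).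
Variable pi : {rmorphism R -> B}.

(* B is the localization of R / I at the image of the prime ideal m. *)
Record is_localized_quotient : Prop := IsLocalizedQuotient {
  lq_sub : {subset I <= m};
  lq_frac : forall x, exists r t, t \notin m /\ x * pi t = pi r;
  lq_ker : forall r, pi r = 0 <-> exists2 u, u \notin m & u * r \in I;
  lq_unit : forall t, t \notin m -> exists b, b * pi t = 1 }.

Hypothesis lq : is_localized_quotient.

Lemma lq_mulI t x y : t \notin m -> x * pi t = y * pi t -> x = y.
Proof.
by move=> /(lq_unit lq)[b bt] E; rewrite -[x]mulr1 -[y]mulr1 -bt mulrCA E mulrCA.
Qed.

Definition extends (Q : prime_idealr R) (Q' : prime_idealr B) :=
  forall x r t, t \notin m -> x * pi t = pi r -> (x \in Q') = (r \in Q).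

Lemma extension_exists (Q : prime_idealr R) : {subset I <= Q} -> {subset Q <= m} ->
  exists Q', extends Q Q'.
Proof.
move=> IQ Qm; pose J x := exists r t, [/\ r \in Q, t \notin m & x * pi t = pi r].
have nQ u : u \notin m -> u \notin Q by apply/contra/Qm.
have JE x r t : t \notin m -> x * pi t = pi r -> J x <-> r \in Q.
  move=> tm xt; split=> [[r' [t' [r'Q t'm xt']]]|rQ]; last by exists r, t.
  have : pi (r * t' - r' * t) = 0.
    by rewrite rmorphB !rmorphM -xt -xt'; ring.
  move=> /(lq_ker lq)[u um /IQ].
  rewrite prime_idealrM (negbTE (nQ _ um)) /= => h.
  have : r * t' \in Q by rewrite -(subrK (r' * t) (r * t')) rpredD // mulrC idealMr.
  by rewrite prime_idealrM (negbTE (nQ _ t'm)) orbF.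
have [||x y|Q' Q'E] := @prime_idealr_of_Prop B J.
- split.
  + exists 0, 1; rewrite idealr0 notin_prime1; split=> //.
    by rewrite mul0r rmorph0.
  + move=> x y [r [t [rQ tm xt]]] [r' [t' [r'Q t'm yt']]].
    exists (r * t' + r' * t), (t * t'); split; last first.
    * by rewrite rmorphD !rmorphM -xt -yt'; ring.
    * exact: notin_primeM.
    * by rewrite rpredD // mulrC idealMr.
  + move=> a x [r [t [rQ tm xt]]]; have [r' [t' [t'm at']]] := lq_frac lq a.
    exists (r' * r), (t' * t); split; [exact: idealMr | exact: notin_primeM |].
    by rewrite !rmorphM -xt -at'; ring.
- move/(JE 1 1 1 (notin_prime1 _)); rewrite rmorph1 mulr1 idealr1.
  by move=> /(_ erefl).
- have [r [t [tm xt]]] := lq_frac lq x; have [r' [t' [t'm yt']]] := lq_frac lq y.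
  rewrite (JE _ _ _ tm xt) (JE _ _ _ t'm yt').
  rewrite (JE (x * y) (r * r') (t * t')) ?notin_primeM //; last first.
    by rewrite !rmorphM -xt -yt'; ring.
  by rewrite prime_idealrM => /orP.
- exists Q' => x r t tm xt; apply/idP/idP => [/Q'E/(JE _ _ _ tm xt)//|rQ].
  by apply/Q'E/(JE _ _ _ tm xt).
Qed.

Lemma extends_pi Q Q' r : extends Q Q' -> (pi r \in Q') = (r \in Q).
Proof. by move=> E; apply: (E _ _ 1); rewrite ?notin_prime1 ?rmorph1 ?mulr1. Qed.

Lemma contraction_exists (Q' : prime_idealr B) :
  exists Q : prime_idealr R, forall r, (r \in Q) = (pi r \in Q').
Proof.
have [||x y|Q QE] := @prime_idealr_of_Prop R (fun r => pi r \in Q').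
- split=> [|x y|a x]; rewrite ?(rmorph0, rmorphD, rmorphM) ?idealr0 //.
  + exact: rpredD.
  + exact: idealMr.
- by rewrite rmorph1 idealr1.
- by rewrite rmorphM prime_idealrM => /orP.
by exists Q => r; apply/idP/idP => /QE.
Qed.

Lemma contraction_chain d (q : nat -> prime_idealr B) : prime_chain d q ->
  exists p : nat -> prime_idealr R, [/\ prime_chain d p,
    {subset I <= p 0%N} & forall i r, (r \in p i) = (pi r \in q i)].
Proof.
move=> qc; have /choice[p pE] := fun i => contraction_exists (q i).
exists p; split=> //.
  move=> i id; have [qi nqi] := qc i id; split=> [r|pi']; first by rewrite !pE => /qi.
  apply: nqi => x xq; have [r [t [tm xt]]] := lq_frac lq x.
  have : r \in p i by apply: pi'; rewrite pE -xt mulrC idealMr.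
  have [b bt] := lq_unit lq tm.
  by rewrite pE -xt => h; rewrite -[x]mulr1 -bt mulrCA idealMr.
move=> r rI; rewrite pE (_ : pi r = 0) ?idealr0 //.
by apply/(lq_ker lq); exists 1; rewrite ?notin_prime1 ?mul1r.
Qed.

Lemma chain_sub (C : comNzRingType) d (p : nat -> prime_idealr C) i j :
  prime_chain d p -> (i <= j <= d)%N -> {subset p i <= p j}.
Proof.
move=> pc; elim: j => [|j IH] /andP[].
  by rewrite leqn0 => /eqP-> _ x.
rewrite leq_eqVlt => /predU1P[->|ij] jd x xi //; apply: (pc j jd).1.
by apply: IH; rewrite // -ltnS ij ltnW.
Qed.

Lemma extension_chain d (p : nat -> prime_idealr R) : prime_chain d p ->
  {subset I <= p 0%N} -> {subset p d <= m} ->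
  exists q : nat -> prime_idealr B, prime_chain d q.
Proof.
move=> pc Ip pm.
have /choice[q qE] : forall i, exists Q', (i <= d)%N -> extends (p i) Q'.
  move=> i; case: (leqP i d) => [id|_]; last first.
    have [Q' _] := extension_exists (lq_sub lq) (fun _ h => h); by exists Q'.
  have [||Q' Q'E] := @extension_exists (p i); last by exists Q'.
  - by move=> r /Ip; apply: (chain_sub pc).
  - by move=> r ri; apply/pm/(chain_sub pc (i := i)); rewrite ?id /=.
exists q => i id; have Ei := qE i (ltnW id); have Ei1 := qE i.+1 id.
have [pii npi] := pc i id; split.
  move=> x; have [r [t [tm xt]]] := lq_frac lq x.
  by rewrite (Ei _ _ _ tm xt) (Ei1 _ _ _ tm xt); apply: pii.
move=> qi; apply: npi => r.
by rewrite -(extends_pi r Ei1) -(extends_pi r Ei); apply: qi.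
Qed.

Lemma lq_local (M : prime_idealr B) : extends m M ->
  local_ring M /\ forall x, x \in M -> forall a, exists b, b * (1 - a * x) = 1.
Proof.
move=> mM.
have unitM x : x \notin M -> exists b, b * x = 1.
  have [r [t [tm xt]]] := lq_frac lq x; rewrite (mM _ _ _ tm xt).
  by move=> /(lq_unit lq)[b br]; exists (b * pi t); rewrite -mulrA [pi t * x]mulrC xt.
have JM (J : idealr B) : {subset J <= M}.
  move=> x xJ; apply: contraFT (idealr1 J) => /unitM[b <-].
  exact: idealMr.
split; last first.
  move=> x xM a; apply: unitM; apply: contraFN (idealr1 M) => h.
  by rewrite -(subrK (a * x) 1) rpredD // idealMr.
split=> [J _|J Jmax]; first exact: JM.
by move=> x; apply/idP/idP; [exact: JM | apply: Jmax; apply: JM].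
Qed.

Lemma lq_acc : ascending_chain_condition R -> ascending_chain_condition B.
Proof.
apply: acc_transfer => x; have [r [t [tm xt]]] := lq_frac lq x.
have [b bt] := lq_unit lq tm; exists r, (pi t), b.
by rewrite mulrC xt; split=> //; rewrite -xt mulrCA bt mulr1.
Qed.

(** Associated primes survive localization; this allows [regular_seq_chain] to start in B at the
    extension of a given associated prime of I. *)
Lemma lq_colon (P : prime_idealr R) (P' : prime_idealr B) f :
  {subset P <= m} -> extends P P' -> (forall a, a \in P <-> a * f \in I) ->
  forall x, x \in P' <-> x * pi f = 0.
Proof.
move=> Pm PP' fP x; have [r [t [tm xt]]] := lq_frac lq x.
rewrite (PP' _ _ _ tm xt); split=> [/fP h|xf].
  apply: (@lq_mulI t) => //; rewrite mulrAC xt -rmorphM mul0r.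
  by apply/(lq_ker lq); exists 1; rewrite ?notin_prime1 ?mul1r.
have /(lq_ker lq)[u um] : pi (r * f) = 0 by rewrite rmorphM -xt mulrAC xf mul0r.
rewrite mulrA => /fP; rewrite prime_idealrM => /orP[/Pm|//].
by rewrite (negbTE um).
Qed.

Lemma ideal_gen_map (C D : comNzRingType) (f : {rmorphism C -> D}) l x :
  ideal_gen (fun g => g \in l) x -> ideal_gen (fun g => g \in map f l) (f x).
Proof.
have iG := is_ideal_gen (fun g => g \in map f l).
apply: (ideal_gen_min (J := fun x => ideal_gen (fun g => g \in map f l) (f x))).
  split=> [|y z|a y]; rewrite ?(rmorph0, rmorphD, rmorphM).
  - exact: is_ideal0.
  - exact: is_idealD.
  - exact: is_idealM.
by move=> y yl; apply: mem_ideal_gen; apply: map_f.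
Qed.

Lemma ideal_gen_lift l x : ideal_gen (fun g => g \in map pi l) x ->
  exists r t, [/\ ideal_gen (fun g => g \in l) r, t \notin m & x * pi t = pi r].
Proof.
have iG := is_ideal_gen (fun g => g \in l).
apply: (ideal_gen_min (J := fun x => exists r t,
  [/\ ideal_gen (fun g => g \in l) r, t \notin m & x * pi t = pi r])).
  split.
  - exists 0, 1; rewrite notin_prime1 mul0r rmorph0; split=> //.
    exact: is_ideal0.
  - move=> y z [r [t [rQ tm xt]]] [r' [t' [r'Q t'm yt']]].
    exists (r * t' + r' * t), (t * t'); split; last first.
    + by rewrite rmorphD !rmorphM -xt -yt'; ring.
    + exact: notin_primeM.
    + by apply: is_idealD => //; apply: is_idealMr.
  - move=> a y [r [t [rQ tm xt]]]; have [r' [t' [t'm at']]] := lq_frac lq a.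
    exists (r' * r), (t' * t); split; [exact: is_idealM | exact: notin_primeM |].
    by rewrite !rmorphM -xt -at'; ring.
move=> _ /mapP[y yl ->]; exists y, 1; rewrite notin_prime1 rmorph1 mulr1.
by split=> //; apply: mem_ideal_gen.
Qed.

(** Regularity modulo I survives localization: clear the denominators of a relation in B, use
    regularity in R, and divide by the denominators again. *)
Lemma lq_regular_seq (g l : seq R) (M : prime_idealr B) :
  extends m M -> (forall x, x \in I <-> ideal_gen (fun y => y \in g) x) ->
  {subset l <= m} ->
  (forall i, (i < size l)%N -> forall b,
     ideal_gen (fun y => y \in g ++ take i l) (l`_i * b) ->
     ideal_gen (fun y => y \in g ++ take i l) b) ->
  regular_seq (map pi l) /\ {subset map pi l <= M}.
Proof.
move=> mM Ig lm lreg.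
have lM : {subset map pi l <= M}.
  by move=> _ /mapP[x /lm xm ->]; rewrite (extends_pi x mM).
split=> //; split; last first.
  move=> h; have := idealr1 M; suff -> : 1 \in M by [].
  by apply: (ideal_gen_min (is_ideal_idealr M) _ h) => y /lM.
rewrite size_map => i il b; rewrite -map_take (nth_map 0) //.
have iG := is_ideal_gen (fun y => y \in map pi (take i l)).
have iGl := is_ideal_gen (fun y => y \in g ++ take i l).
have [r [t [tm bt]]] := lq_frac lq b => h.
have [r' [t' [r'G t'm E]]] := ideal_gen_lift h.
have /(lq_ker lq)[u um] : pi (l`_i * r * t' - r' * t) = 0.
  by rewrite rmorphB !rmorphM -bt -E; ring.
move=> /Ig/(ideal_gen_sub (T := fun y => y \in g ++ take i l)).
move=> /(_ (fun y yg => ltac:(by rewrite mem_cat yg))) uG.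
have r'G' : ideal_gen (fun y => y \in g ++ take i l) r'.
  by apply: ideal_gen_sub r'G => y yl; rewrite mem_cat yl orbT.
have /(lreg i il) : ideal_gen (fun y => y \in g ++ take i l) (l`_i * (u * r * t')).
  have -> : l`_i * (u * r * t') = u * (l`_i * r * t' - r' * t) + u * t * r' by ring.
  by apply: is_idealD => //; apply: is_idealM.
move=> /(ideal_gen_map pi); rewrite map_cat => urt.
have {}urt : ideal_gen (fun y => y \in map pi (take i l)) (pi (u * r * t')).
  apply: (ideal_gen_min iG _ urt) => y; rewrite mem_cat => /orP[/mapP[z zg ->]|].
    have -> : pi z = 0; last exact: is_ideal0 iG.
    apply/(lq_ker lq); exists 1; rewrite ?notin_prime1 ?mul1r //.
    by apply/Ig; apply: mem_ideal_gen.
  by move=> yl; apply: mem_ideal_gen.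
have [c ct] := lq_unit lq (notin_primeM (notin_primeM um tm) t'm).
have -> : b = c * pi (u * r * t').
  by rewrite !rmorphM -bt -[LHS]mulr1 -ct !rmorphM; ring.
exact: is_idealM.
Qed.

End LocalizedQuotients.

Lemma quotient_prime (A : comNzRingType) (I : idealr A) (Q : prime_idealr A) :
  {subset I <= Q} -> exists P : prime_idealr {ideal_quot I},
    forall a, (quot_map I a \in P) = (a \in Q).
Proof.
move=> IQ; pose J u := exists2 a, u = quot_map I a & a \in Q.
have JE a : J (quot_map I a) <-> a \in Q.
  split=> [[b E bQ]|aQ]; last by exists a.
  rewrite -(subrK b a) rpredD //; apply: IQ; apply/quot_map_eq0.
  by rewrite rmorphB E subrr.
have [||x y|P PE] := @prime_idealr_of_Prop _ J.
- split.
  + by exists 0; rewrite ?rmorph0 ?idealr0.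
  + by move=> _ _ [a -> aQ] [b -> bQ]; exists (a + b); rewrite ?rmorphD ?rpredD.
  + move=> u _ [b -> bQ]; have [a ->] := quot_map_surj u.
    by exists (a * b); rewrite ?rmorphM ?idealMr.
- by rewrite -(rmorph1 (quot_map I)) => /JE; rewrite idealr1.
- have [a ->] := quot_map_surj x; have [b ->] := quot_map_surj y.
  by rewrite -rmorphM !JE prime_idealrM => /orP.
by exists P => a; apply/idP/idP => [/PE/JE|/JE/PE].
Qed.

Lemma localized_quotient (R : comNzRingType) (I : idealr R) (m : prime_idealr R)
    (P : prime_idealr {ideal_quot I}) :
  (forall a, (quot_map I a \in P) = (a \in m)) ->
  is_localized_quotient I m (loc_map P \o quot_map I).
Proof.
move=> PE; split.
- by move=> r /quot_map_eq0 r0; rewrite -PE r0 idealr0.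
- move=> x; have [a [s [sP ->]]] := locfracP x.
  have [r rE] := quot_map_surj a; have [t tE] := quot_map_surj s.
  exists r, t; rewrite -PE -tE sP; split=> //=.
  by rewrite -tE -rE; apply: locmul_map.
- move=> r /=; rewrite loc_map_eq0; split=> [[s sP]|[u um urI]].
    have [u uE] := quot_map_surj s; rewrite uE -rmorphM => /quot_map_eq0 urI.
    by exists u; rewrite // -PE -uE.
  by exists (quot_map I u); [rewrite PE | rewrite -rmorphM; apply/quot_map_eq0].
- move=> t; rewrite -PE => tP; exists (locfrac 1 tP).
  by rewrite /= locmul_map rmorph1.
Qed.

Lemma maximal_inverse (A : comNzRingType) (P : idealr A) a :
  maximal_ideal P -> a \notin P -> exists b, b * a - 1 \in P.
Proof.
move=> Pmax aP; apply: contrapT => /forallNP nb.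
have iJ := is_idealDM a (is_ideal_idealr P).
have [|J JE] := idealr_of_Prop iJ.
  move=> [p pP [b E]]; apply: (nb b); rewrite E opprD addrCA subrr addr0.
  by rewrite rpredN.
move/negP: aP; apply; apply: (Pmax J).
  by move=> p pP; apply/JE; exists p => //; exists 0; rewrite mul0r addr0.
by apply/JE; exists 0; [exact: idealr0 | exists 1; rewrite mul1r add0r].
Qed.

(** * Cohen-Macaulay implies unmixed *)

Section CohenMacaulayMonomial.
Variables (K : fieldType) (n : nat).
Local Notation R := {mpoly K[n]}.
Variables (I : idealr R) (G : {fset 'X_{1..n}}).
Hypothesis genI : generates (monomials_in (fun m => m \in G)) I.

(** Modulo the variables a polynomial is its constant term, and a nonzero constant is a unit. *)
Lemma var_prime_setT_maximal (P : prime_idealr {ideal_quot I}) :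
  (forall a, (quot_map I a \in P) = (a \in var_prime K [set: 'I_n])) ->
  maximal_ideal P.
Proof.
move=> PE J PJ u uJ; have [r rE] := quot_map_surj u; rewrite rE PE.
have r0 : r - (r@_0%MM)%:MP \in var_prime K [set: 'I_n].
  apply/in_var_prime => m; rewrite mcoeff_msupp mcoeffB mcoeffC => rm.
  apply: contraNT rm => /exists_inPn m0.
  have -> : m = 0%MM.
    by apply/mnmP => i; rewrite mnm0E; have := m0 i (in_setT i); rewrite negbK => /eqP.
  by rewrite eqxx mulr1 subrr.
have [c0|c0] := eqVneq r@_0%MM 0; first by rewrite c0 mpolyC0 subr0 in r0.
have : quot_map I (r@_0%MM)%:MP \in J.
  rewrite -[_%:MP](subKr r) rmorphB -rE rpredB //; apply: PJ.
  by rewrite PE.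
move=> /(idealMr (quot_map I ((r@_0%MM)^-1)%:MP)).
by rewrite -rmorphM -mpolyCM mulVf // mpolyC1 rmorph1 idealr1.
Qed.

Theorem cohen_macaulay_unmixed : cohen_macaulay {ideal_quot I} -> unmixed I.
Proof.
move=> [_ CM]; pose m := var_prime K [set: 'I_n].
have Im : {subset I <= m}.
  apply: (sub_var_prime genI) => g /(generator_neq0 genI) g0; apply/hitsP.
  apply: contrapT => /forall2NP gi; case/eqP: g0; apply/mnmP => i.
  rewrite mnm0E; apply/eqP; case: (gi i) => [[]|/negP]; first exact: in_setT.
  by rewrite negbK.
have [P PE] := quotient_prime Im.
have [M' [M'max M'uniq] [d kd [[s [sM' sreg sd]] _]]] :=
  CM P (var_prime_setT_maximal PE).
have lq := localized_quotient PE.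
have [M mM] := extension_exists lq Im (fun _ h => h).
have [[Mmax _] Mu] := lq_local lq mM.
have sM : {subset s <= M} by move=> x /sM'; rewrite (M'uniq M Mmax).
exists (n - d)%N => Q aQ.
have [S [QS _]] := associated_prime_monomial genI aQ.
have [f fQ] := (associated_primeP _ _).1 aQ.
have IQ : {subset I <= Q} by move=> a aI; apply/fQ; rewrite mulrC idealMr.
have Qm : {subset Q <= m}.
  move=> a; rewrite QS; apply: var_prime_subset; exact: subsetT.
have [Q' QQ'] := extension_exists lq IQ Qm.
(* The regular sequence of length d gives a chain of length d from Q'; contracted to R it starts at
   Q = P_S, so d + #|S| <= n. *)
have [q [qc q0]] := regular_seq_chain (lq_acc lq (@acc_mpoly K n))
  (fun x xs => Mu x (sM x xs)) sreg (lq_colon lq Qm QQ' fQ).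
have [p [pc _ pE]] := contraction_chain lq qc.
have le1 : (d + #|S| <= n)%N.
  rewrite -sd; apply: prime_chain_var_bound pc _ => i iS.
  by rewrite pE q0 (extends_pi _ QQ') QS var_in_var_prime.
(* The n - #|S| steps from P_S to the ideal of all variables extend to the localization, whose
   dimension is d; so n - #|S| <= d. *)
have [w [wc wS wn]] := var_chain_through K S.
have Sn : (#|S| <= n)%N by apply: leq_trans le1; apply: leq_addl.
have [||| z /(kd.2) le2] :=
  @extension_chain _ _ _ _ _ lq (n - #|S|) (fun i => w (#|S| + i)%N).
- move=> i id; rewrite addnS; apply: wc; by rewrite -ltn_subRL.
- by move=> r /IQ; rewrite addn0 wS QS.
- by rewrite subnKC // wn.
have -> : (n - d)%N = #|S|.
  by apply/eqP; rewrite eqn_leq leq_subLR leq_subRL; lia.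
by apply: eq_prime_height (prime_height_var_prime K S) => x; rewrite QS.
Qed.

End CohenMacaulayMonomial.

Lemma comNzRing_field (L : comNzRingType) :
  (forall x : L, x != 0 -> exists y, y * x = 1) ->
  exists F : fieldType, (F : comNzRingType) = L.
Proof.
case: L => T [? ? ? ? ? ? ? ? ? ? ? ?]; set L := GRing.ComNzRing.Pack _.
move=> hinv; have /choice[i iP] : forall x : L, exists y,
    if x == 0 then y = 0 else y * x = 1.
  move=> x; case: eqVneq => [_|/hinv//]; by exists 0.
have mulVf x : x != 0 -> i x * x = 1 by move/negbTE => x0; have := iP x; rewrite x0.
have inv0 : i 0 = 0 by have := iP 0; rewrite eqxx.
pose F : fieldType := HB.pack_for fieldType L
  (GRing.ComNzRing_isField.Build L mulVf inv0).
by exists F.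
Qed.

(** The images of the variables generate L over K, so Zariski's lemma makes every element of L
    algebraic. *)
Lemma maximal_ideal_algebraic (K : fieldType) (n : nat) (L : comNzRingType)
    (f : {rmorphism {mpoly K[n]} -> L}) :
  (forall y, exists r, y = f r) -> (forall x : L, x != 0 -> exists y, y * x = 1) ->
  forall r, exists2 p : {poly K}, p \is monic & f (map_poly (@mpolyC n K) p).[r] = 0.
Proof.
move=> fsurj /comNzRing_field[F FL]; case: L / FL f fsurj => f fsurj r.
pose psi : {rmorphism K -> F} := f \o @mpolyC n K.
have [y|p pm /rootP pr] := @zariski K F psi [seq f 'X_i | i <- enum 'I_n] _ (f r).
  move=> T Tsub Tpsi Tx; have [q ->] := fsurj y.
  have T0 : T 0 by have := Tpsi 0; rewrite rmorph0.
  have TD x z : T x -> T z -> T (x + z).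
    move=> Tx' Tz; rewrite -[z]opprK; apply: (Tsub _ _ _ _).1 => //.
    by rewrite -sub0r; apply: (Tsub _ _ _ _).1.
  rewrite [q]mpolyE rmorph_sum; apply: (big_ind T) => // m _.
  rewrite -mul_mpolyC rmorphM; apply: (Tsub _ _ _ _).2; first exact: Tpsi.
  rewrite mpolyXE_id rmorph_prod; apply: (big_ind T) => //.
  - by have := Tpsi 1; rewrite rmorph1.
  - by move=> x z Tx' Tz; apply: (Tsub _ _ _ _).2.
  move=> i _; rewrite rmorphXn; elim: (m i) => [|k IH].
    by have := Tpsi 1; rewrite rmorph1 expr0.
  rewrite exprS; apply: (Tsub _ _ _ _).2 => //; apply: Tx.
  by apply: map_f; rewrite mem_enum.
exists p => //; rewrite -horner_map -map_poly_comp -[RHS]pr.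
by [].
Qed.

(** * Complete intersections are Cohen-Macaulay *)

Section Substitutions.
Variables (K : fieldType) (n : nat).
Local Notation R := {mpoly K[n]}.

Lemma mpoly_morph_id (f : {rmorphism R -> R}) :
  (forall c, f c%:MP = c%:MP) -> (forall i, f 'X_i = 'X_i) -> f =1 id.
Proof.
move=> fC fX p; rewrite [in RHS](mpolyE p) [in LHS](mpolyE p) rmorph_sum.
apply: eq_bigr => m _; rewrite -!mul_mpolyC rmorphM fC mpolyXE_id rmorph_prod.
by congr (_ * _); apply: eq_bigr => i _; rewrite rmorphXn fX.
Qed.

Lemma mlead_univariate (p : {poly K}) i : p != 0 ->
  (map_poly (@mpolyC n K) p).['X_i] != 0 /\
  mlead (map_poly (@mpolyC n K) p).['X_i] = (U_(i) *+ (size p).-1)%MM.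
Proof.
have Xi0 : 'X_i != 0 :> R by rewrite -msupp_eq0 msuppX.
elim/poly_ind: p => [|q c IH]; first by rewrite eqxx.
rewrite size_MXaddC rmorphD rmorphM /= map_polyX map_polyC hornerMXaddC.
have [->|q0] := eqVneq q 0.
  rewrite mul0r add0r polyC_eq0 => c0.
  rewrite rmorph0 horner0 mul0r add0r (negbTE c0) andbF size_poly0 mleadC.
  by rewrite mpolyC_eq0.
move=> _; have [qx0 qxm] := IH q0.
have lead : mlead ((map_poly (@mpolyC n K) q).['X_i] * 'X_i) = (U_(i) *+ size q)%MM.
  rewrite mleadM // qxm mleadXm -mulmSr prednK //.
  by rewrite size_poly_gt0.
have sq : (0 < mdeg (U_(i) *+ size q)%MM)%N.
  by rewrite mdegMn mdeg1 mul1n size_poly_gt0.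
have lead' : mlead ((map_poly (@mpolyC n K) q).['X_i] * 'X_i + c%:MP) =
    (U_(i) *+ size q)%MM.
  rewrite mleadDl ?lead // mleadC.
  by apply: lt_mdeg_ltmc; rewrite mdeg0.
rewrite lead'; split=> //; apply: contraTneq sq => E.
by rewrite -lead' E mlead0 mdeg0.
Qed.

Lemma ltmc_mnm1 (i j : 'I_n) : (i < j)%N -> (U_(j)%MM < U_(i)%MM)%O.
Proof.
move=> ij; apply/ltmcP; first by rewrite !mdeg1.
have ne : (j == i) = false by apply/negbTE; rewrite -val_eqE /= gtn_eqF.
exists i; last by rewrite !mnm1E eqxx ne.
move=> k ki; rewrite !mnm1E -!val_eqE /=.
by rewrite (gtn_eqF ki) (gtn_eqF (ltn_trans ki ij)).
Qed.

Variable t : 'I_n -> 'I_n.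
Hypothesis t_le : forall i, (t i <= i)%N.
Hypothesis t_idem : forall i, t (t i) = t i.

(** Variables of smaller index are larger in the monomial order, so x_(t i) leads the image of x_i.
    Idempotence of [t] makes [unshear] the inverse. *)
Definition shear : {rmorphism R -> R} :=
  comp_mpoly [tuple if t i == i then 'X_i else 'X_i + 'X_(t i) | i < n].
Definition unshear : {rmorphism R -> R} :=
  comp_mpoly [tuple if t i == i then 'X_i else 'X_i - 'X_(t i) | i < n].

Lemma shearC c : shear c%:MP = c%:MP.
Proof. exact: comp_mpolyC. Qed.

Lemma unshearC c : unshear c%:MP = c%:MP.
Proof. exact: comp_mpolyC. Qed.

Lemma shearX i : shear 'X_i = if t i == i then 'X_i else 'X_i + 'X_(t i).
Proof. by rewrite /shear /= comp_mpolyXU -tnth_nth tnth_mktuple. Qed.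

Lemma unshearX i : unshear 'X_i = if t i == i then 'X_i else 'X_i - 'X_(t i).
Proof. by rewrite /unshear /= comp_mpolyXU -tnth_nth tnth_mktuple. Qed.

Lemma shearK : cancel shear unshear.
Proof.
apply: (@mpoly_morph_id (unshear \o shear)) => [c|i] /=.
  by rewrite shearC unshearC.
rewrite shearX; case: ifP => ti; first by rewrite unshearX ti.
by rewrite rmorphD !unshearX ti t_idem eqxx subrK.
Qed.

Lemma shear_unshearX i : shear (unshear 'X_i) = 'X_i.
Proof.
rewrite unshearX; case: ifP => ti; first by rewrite shearX ti.
by rewrite rmorphB !shearX ti t_idem eqxx addrK.
Qed.

Lemma mlead_shearX i : mlead (shear 'X_i) = U_(t i)%MM.
Proof.
rewrite shearX; case: (eqVneq (t i) i) => [->|ti]; first by rewrite mleadXm.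
rewrite mleadDr !mleadXm //; apply: ltmc_mnm1.
by rewrite ltn_neqAle t_le andbT.
Qed.

Lemma mlead_shear_monomial (m : 'X_{1..n}) k : (forall i, m i != 0%N -> t i = k) ->
  mlead (shear 'X_[m]) = (U_(k) *+ mdeg m)%MM.
Proof.
move=> mk; have nz (i : 'I_n) : shear ('X_i) ^+ m i != 0.
  rewrite expf_neq0 //; apply: contra_eq_neq (mlead_shearX i) => ->.
  by rewrite mlead0 eq_sym mnm1_eq0.
rewrite mpolyXE_id rmorph_prod /=.
under eq_bigr do rewrite rmorphXn.
rewrite mlead_prod => [|i _ _]; last exact: nz.
apply/mnmP => j; rewrite mnm_sumE mulmnE mdegE mulnC big_distrl /=.
apply: eq_bigr => i _; case: (eqVneq (m i) 0%N) => [->|mi].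
  by rewrite expr0 mlead1 mnm0E mul0n.
rewrite mleadX ?mlead_shearX ?mulmnE ?(mk i mi) 1?mulnC //.
by have := nz i; rewrite expf_eq0 lt0n mi.
Qed.

End Substitutions.

Section CompleteIntersections.
Variables (K : fieldType) (n : nat).
Local Notation R := {mpoly K[n]}.
Variables (I : idealr R) (G : {fset 'X_{1..n}}).
Hypothesis genI : generates (monomials_in (fun m => m \in G)) I.

(** If x_i divided two generators, x_i and one variable from each other generator would generate a
    P_S containing I, of height less than the number of generators. *)
Lemma height_coprime : height I #|` G| ->
  forall (g g' : 'X_{1..n}) i,
  g \in G -> g' \in G -> g i != 0%N -> g' i != 0%N -> g = g'.
Proof.
move=> [_ Ih] g g' i gG g'G gi g'i; apply/eqP; apply: contraT => gg'.
have /choice[k kP] : forall m, exists k, m \in G -> m k != 0%N.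
  move=> m; case: (boolP (m \in G)) => [mG|_]; last by exists i.
  apply: contrapT => /forallNP mk; case/eqP: (generator_neq0 genI mG).
  by apply/mnmP => j; rewrite mnm0E; apply: contrapT => /eqP mj; apply: (mk j).
pose G' := (G `\ g `\ g')%fset.
pose S := i |: [set j in map k G'].
have IS : {subset I <= var_prime K S}.
  apply: (sub_var_prime genI) => m mG; apply/hitsP.
  have [->|mg] := eqVneq m g; first by exists i; rewrite ?setU11.
  have [->|mg'] := eqVneq m g'; first by exists i; rewrite ?setU11.
  exists (k m); last exact: kP.
  by rewrite setU1r // inE; apply: map_f; rewrite !inE mg mg'.
have := (prime_height_var_prime K S).2 _ (Ih _ IS).
rewrite leqNgt => /negP[].
apply: (@leq_ltn_trans (1 + #|` G'|)).
  apply: leq_trans (leq_card_setU _ _) _; rewrite cards1 leq_add2l cardsE.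
  by apply: leq_trans (card_size _) _; rewrite size_map.
rewrite (cardfsD1 g G) gG (cardfsD1 g' (G `\ g)%fset) !inE g'G.
by rewrite eq_sym gg' ltn_add2l.
Qed.

Definition leads (m : 'X_{1..n}) (k : 'I_n) :=
  m k != 0%N /\ forall j : 'I_n, (j < k)%N -> m j = 0%N.

Lemma leads_exists (m : 'X_{1..n}) i : m i != 0%N -> exists2 k, leads m k & (k <= i)%N.
Proof.
move=> mi; case: (@arg_minnP _ i (fun k => m k != 0%N) (fun k => k) mi) => k mk kmin.
exists k; last exact: kmin.
by split=> // j; apply: contraTeq => mj; rewrite -leqNgt; apply: kmin.
Qed.

Lemma leads_uniq (m : 'X_{1..n}) k l : leads m k -> leads m l -> k = l.
Proof.
move=> [mk kmin] [ml lmin]; case: (ltngtP k l) => [kl|lk|]; last exact: val_inj.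
- by rewrite lmin in mk.
- by rewrite kmin in ml.
Qed.

(* The shear x_i |-> x_i + x_(t i) moves the leading monomial of every
   generator to a pure power of its first variable, so that together with one
   polynomial in each of the remaining variables we obtain a family whose
   leading monomials are powers of distinct variables. *)
Lemma regular_parameters (m : prime_idealr R) : height I #|` G| ->
  (forall r, exists2 p : {poly K}, p \is monic &
     (map_poly (@mpolyC n K) p).[r] \in m) ->
  exists g l : seq R, [/\ forall x, x \in I <-> ideal_gen (fun y => y \in g) x,
    {subset l <= m}, (size l + #|` G|)%N = n &
    forall i, (i < size l)%N -> forall b,
      ideal_gen (fun y => y \in g ++ take i l) (l`_i * b) ->
      ideal_gen (fun y => y \in g ++ take i l) b].
Proof.
move=> /height_coprime cop alg.
pose T := [set k | `[< exists2 g, g \in G & leads g k >]].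
have /choice[c cP] : forall k, exists g, k \in T -> g \in G /\ leads g k.
  move=> k; case: (boolP (k \in T)) => [|_]; last by exists 0%MM.
  by rewrite inE => /asboolP[g gG gk]; exists g.
have TP g k : g \in G -> leads g k -> k \in T.
  by move=> gG gk; rewrite inE; apply/asboolP; exists g.
(* t i is the first variable of the generator divisible by x_i, unique by coprimality, or i itself
   if there is none. *)
have /choice[t tP] : forall i : 'I_n, exists k : 'I_n, (k <= i)%N /\
    ((exists g : 'X_{1..n}, [/\ g \in G, g i != 0%N & leads g k]) \/
     (k = i /\ forall g : 'X_{1..n}, g \in G -> g i = 0%N)).
  move=> i.
  case: (pselect (exists2 g : 'X_{1..n}, g \in G & g i != 0%N)) => [[g gG gi]|ng].
    by have [k gk ki] := leads_exists gi; exists k; split=> //; left; exists g.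
  exists i; split=> //; right; split=> // g gG; apply/eqP.
  by apply: contra_notT ng => gi; exists g.
have t_le i : (t i <= i)%N by have [] := tP i.
have tE (g : 'X_{1..n}) i k : g \in G -> g i != 0%N -> leads g k -> t i = k.
  move=> gG gi gk; have [_ [[g' [g'G g'i g'k]]|[_ /(_ g gG) gi0]]] := tP i.
    by rewrite (cop _ _ _ g'G gG g'i gi) in g'k; apply: leads_uniq g'k gk.
  by rewrite gi0 in gi.
have t_idem i : t (t i) = t i.
  have [_ [[g [gG _ gk]]|[ti _]]] := tP i; last by rewrite !ti.
  by apply: (tE g _ _ gG _ gk); case: gk.
(* Evaluating at the unsheared x_i lets the shear turn H i into a polynomial in x_i alone. *)
have /choice[H HP] : forall i, exists p : {poly K}, p \is monic /\
    (map_poly (@mpolyC n K) p).[unshear K t 'X_i] \in m.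
  by move=> i; have [p pm pr] := alg (unshear K t 'X_i); exists p.
pose F i : R := if i \in T then 'X_[c i]
  else (map_poly (@mpolyC n K) (H i)).[unshear K t 'X_i].
pose d i := if i \in T then mdeg (c i) else (size (H i)).-1.
have X0 u : 'X_[u] != 0 :> R by rewrite -msupp_eq0 msuppX.
have HE i : shear K t (map_poly (@mpolyC n K) (H i)).[unshear K t 'X_i] =
    (map_poly (@mpolyC n K) (H i)).['X_i].
  rewrite -horner_map shear_unshearX // -map_poly_comp; congr (_.[_]).
  by apply: eq_map_poly => a /=; rewrite shearC.
have sF0 i : shear K t (F i) != 0.
  rewrite /F; case: ifP => _.
    apply: contra_neq (X0 (c i)) => E.
    by rewrite -[LHS](shearK t_idem) E rmorph0.
  by rewrite HE; case: (@mlead_univariate K n (H i) i); rewrite ?monic_neq0 ?(HP i).1.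
have sFm i : mlead (shear K t (F i)) = (U_(i) *+ d i)%MM.
  rewrite /F /d; case: (boolP (i \in T)) => [iT|_].
    apply: mlead_shear_monomial => // j cij; have [cG ci] := cP i iT.
    exact: tE cG cij ci.
  by rewrite HE; case: (@mlead_univariate K n (H i) i); rewrite ?monic_neq0 ?(HP i).1.
have TG : #|T| = #|` G|.
  rewrite cardE; apply/eqP; rewrite eqn_leq; apply/andP; split.
    rewrite -(size_map c); apply: uniq_leq_size.
      rewrite map_inj_in_uniq ?enum_uniq // => i j.
      rewrite !mem_enum => /cP[_ ci] /cP[_ cj] cij.
      by rewrite cij in ci; apply: leads_uniq ci cj.
    by move=> _ /mapP[i + ->]; rewrite mem_enum => /cP[].
  rewrite -(size_map c); apply: uniq_leq_size; first exact: fset_uniq.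
  move=> g gG; have [i gi] : exists i, g i != 0%N.
    apply: contrapT => /forallNP g0; case/eqP: (generator_neq0 genI gG).
    by apply/mnmP => j; rewrite mnm0E; apply: contrapT => /eqP/g0.
  have [k gk _] := leads_exists gi; have kT := TP g k gG gk.
  apply/mapP; exists k; first by rewrite mem_enum.
  by have [cG ck] := cP k kT; apply: (cop _ _ k gG cG); [case: gk | case: ck].
exists (map F (enum T)), (map F (enum (~: T))); split.
- move=> x; split=> [/genI|].
    apply: (ideal_gen_min (is_ideal_gen (fun y => y \in map F (enum T)))).
    move=> _ [g gG ->].
    have [i gi] : exists i, g i != 0%N.
      apply: contrapT => /forallNP g0; case/eqP: (generator_neq0 genI gG).
      by apply/mnmP => j; rewrite mnm0E; apply: contrapT => /eqP/g0.
    have [k gk _] := leads_exists gi; have kT := TP g k gG gk.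
    apply: mem_ideal_gen; apply/mapP; exists k; first by rewrite mem_enum.
    have [cG ck] := cP k kT; rewrite /F kT; congr 'X_[_].
    by apply: (cop _ _ k gG cG); [case: gk | case: ck].
  apply: (ideal_gen_min (is_ideal_idealr I)) => _ /mapP[k + ->].
  rewrite mem_enum => kT; rewrite /F kT; have [cG _] := cP k kT.
  by apply/(mpolyX_generated genI); exists (c k); rewrite ?lepm_refl.
- move=> _ /mapP[k + ->]; rewrite mem_enum inE => kT.
  by rewrite /F (negbTE kT); case: (HP k).
- by rewrite size_map -cardE -TG addnC cardsC card_ord.
rewrite size_map => i iT b.
have [y0 _] : exists y0 : 'I_n, True.
  by case: (enum (~: T)) iT => // y *; exists y.
rewrite (nth_map y0) // -map_take -map_cat; set vs := _ ++ _; set y := nth _ _ _.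
have uvs : uniq (rcons vs y).
  rewrite -cats1 -catA cats1 -take_nth //.
  apply: subseq_uniq (_ : uniq (enum T ++ enum (~: T))).
    by rewrite cat_subseq ?take_subseq.
  rewrite cat_uniq !enum_uniq andbT /=; apply/hasPn => j.
  by rewrite !mem_enum inE.
have unF : map (unshear K t) (map (fun j => shear K t (F j)) vs) = map F vs.
  by rewrite -map_comp; apply: eq_map => j; apply: shearK t_idem (F j).
(* Regularity is obtained after the shear, from [gen_regular], and carried back by [unshear]. *)
move=> /(ideal_gen_map (shear K t)); rewrite rmorphM -map_comp.
move=> /(gen_regular sF0 sFm uvs)/(ideal_gen_map (unshear K t)).
by rewrite unF (shearK t_idem b).
Qed.

Theorem complete_intersection_cohen_macaulay :
  height I #|` G| -> cohen_macaulay {ideal_quot I}.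
Proof.
move=> hI; have accR := @acc_mpoly K n.
have accA : ascending_chain_condition {ideal_quot I}.
  apply: acc_transfer accR => u; have [a ->] := quot_map_surj u.
  by exists a, 1, 1; rewrite !mul1r.
split; first exact: acc_noetherian.
move=> P Pmax; have [m mE] := contraction_exists (quot_map I) P.
have PE a : (quot_map I a \in P) = (a \in m) by rewrite mE.
have lq := localized_quotient PE.
have alg r : exists2 p : {poly K}, p \is monic &
    (map_poly (@mpolyC n K) p).[r] \in m.
  have [y|x x0|p pm pr] := @maximal_ideal_algebraic K n {ideal_quot P}
      (quot_map P \o quot_map I) _ _ r.
  - have [a ->] := quot_map_surj y; have [b ->] := quot_map_surj a.
    by exists b.
  - have [a xE] := quot_map_surj x.
    have aP : a \notin P.
      by apply: contra x0 => /quot_map_eq0 a0; rewrite xE a0.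
    have [b bP] := maximal_inverse Pmax aP; exists (quot_map P b).
    apply/subr0_eq; rewrite xE -rmorphM -(rmorph1 (quot_map P)) -rmorphB.
    exact/quot_map_eq0.
  - by exists p; rewrite // -PE; apply/quot_map_eq0.
have [g [l [gI lm lG lreg]]] := regular_parameters hI alg.
have [M mM] := extension_exists lq (lq_sub lq) (fun _ h => h).
have [Mloc Mu] := lq_local lq mM.
have [sreg sM] := lq_regular_seq lq mM gI lm lreg.
have accB := lq_acc lq accR.
have [u [P0 P0E]] := acc_associated_zero accB.
have bound e (q : nat -> prime_idealr (localization P)) :
    prime_chain e q -> (e <= size l)%N.
  move=> qc; have [p [pc Ip _]] := contraction_chain lq qc.
  have IS := sub_var_prime genI (prime_hits genI Ip).
  have GS := (prime_height_var_prime K [set i | 'X_i \in p 0%N]).2 _ (hI.2 _ IS).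
  have eS := prime_chain_var_bound (S := [set i | 'X_i \in p 0%N]) pc
    (fun i => ltac:(by rewrite inE)).
  rewrite -(leq_add2r #|` G|) lG; apply: leq_trans eS.
  by rewrite leq_add2l.
(* From an associated prime of 0, a regular sequence in M yields a chain of its own length: l
   attains the bound, and no regular sequence exceeds it. *)
exists M => //; exists (size l); split.
- have [q [qc _]] := regular_seq_chain accB (fun x xs => Mu x (sM x xs)) sreg P0E.
  by exists q; rewrite size_map in qc.
- exact: bound.
- by exists (map (loc_map P \o quot_map I) l); rewrite size_map.
- move=> s s_M s_reg.
  have [q [qc _]] := regular_seq_chain accB (fun x xs => Mu x (s_M x xs)) s_reg P0E.
  exact: bound qc.
Qed.

End CompleteIntersections.

(** * Equivalence of the three conditions *)

Theorem proposition1p12 (K : fieldType) (n : nat) (I : idealr {mpoly K[n]})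
    (I_monomial : monomial_ideal I) (I_dominant : dominant I) :
  (cohen_macaulay {ideal_quot I} <-> unmixed I) /\
  (unmixed I <-> complete_intersection I).
Proof.
have [G minG domG] := I_dominant; have [genI _] := minG.
have CM_unmixed := @cohen_macaulay_unmixed K n I G genI.
have unmixed_height := unmixed_complete_intersection genI domG.
have height_CM := @complete_intersection_cohen_macaulay K n I G genI.
split; split=> //.
- by move=> /unmixed_height/height_CM.
- by move=> /unmixed_height hI; exists G.
(* The minimal generating set H given here is used directly, without comparing it with G. *)
- by move=> [H [genH _] /(complete_intersection_unmixed genH)].
Qed.
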